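(* Let $\sigma$ be a continuous measure on $\mathbb{T}$. If $V_\sigma^{\odot n}$ has simple spectrum for infinitely many $n\in\mathbb{N}$, then for every $k\geq 1$ the measure $\sigma^{\ast k}$ has the CS($k+1$) property.
   Context: All measures on the circle $\mathbb{T}=\{z\in\mathbb{C}:|z|=1\}$ are positive finite Borel measures; continuous means having no atoms; $\sigma^{\ast k}$ is the $k$-th convolution power. $V_\sigma$ is the unitary operator on $L^2(\mathbb{T},\sigma)$ given by $(V_\sigma f)(z)=zf(z)$. For a unitary operator $U$ on a separable Hilbert space $H$, $U^{\otimes n}$ acts on $H^{\otimes n}$ by $x_1\otimes\dots\otimes x_n\mapsto Ux_1\otimes\dots\otimes Ux_n$, and $U^{\odot n}$ is its restriction to the symmetric tensor power $H^{\odot n}$, the subspace of elements of $H^{\otimes n}$ fixed by all operators $x_1\otimes\dots\otimes x_n\mapsto x_{\pi(1)}\otimes\dots\otimes x_{\pi(n)}$, $\pi\in S(n)$ (the symmetric group). A unitary operator has simple spectrum if its spectral multiplicity function equals $1$ almost everywhere with respect to its maximal spectral type (equivalently, the operator has a cyclic vector). A measure $\tau$ on $\mathbb{T}$ has the CS($n$) property (convolution singularity of order $n$) if $\tau\perp\nu_1\ast\dots\ast\nu_n$ for any continuous measures $\nu_1,\dots,\nu_n$ on $\mathbb{T}$. *)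

(* Defs.v *)
From HB Require Import structures.
From mathcomp Require Import all_boot all_order all_algebra.
From mathcomp Require Import ring_quotient sesquilinear perm complex ring lra.
From mathcomp Require Import all_classical all_reals all_analysis.
From mathcomp Require Import measurable_realfun.

Set Implicit Arguments.
Unset Strict Implicit.
Unset Printing Implicit Defensive.
Import Order.TTheory GRing.Theory Num.Theory.
Import numFieldTopology.Exports numFieldNormedType.Exports.

Local Open Scope classical_set_scope.
Local Open Scope ring_scope.
Local Open Scope quotient_scope.

Section Circle.
Variable R : realType.

Record circle := Circle { circle_val :> R[i]; circle_valP : `|circle_val| == 1 }.

HB.instance Definition _ := [isSub for circle_val].
HB.instance Definition _ := [Choice of circle by <:].

Lemma circle1_subproof : `|1 : R[i]| == 1.
Proof. by rewrite normr1. Qed.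
Definition circle1 : circle := Circle circle1_subproof.

Lemma circle_mul_subproof (z w : circle) : `|(z : R[i]) * w| == 1.
Proof. by rewrite normrM (eqP (circle_valP z)) (eqP (circle_valP w)) mulr1. Qed.
Definition circle_mul (z w : circle) : circle := Circle (circle_mul_subproof z w).

HB.instance Definition _ := isPointed.Build circle circle1.

Definition circle_coord (z : circle) : R * R := (complex.Re z, complex.Im z).

(* The subspace topology of the circle in C = R^2, and the Borel sigma-algebra
   generated by its open sets. *)
HB.instance Definition _ :=
  Topological.copy circle (initial_topology circle_coord).

HB.instance Definition _ := Measurable.copy circle
   (g_sigma_algebraType (@open circle)).


Lemma open_measurable_prod (W : set (R * R)) : open W -> measurable W.
Proof.
move=> oW.
pose B (q : rat * rat * rat) : set (R * R) :=
  ball (ratr q.1.1 : R) (ratr q.2) `*` ball (ratr q.1.2 : R) (ratr q.2).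
have -> : W = \bigcup_(q in [set q | B q `<=` W]) B q.
  apply/seteqP; split; last by move=> z [q /= qW]; exact: qW.
  move=> [x y] Wxy; have := oW; rewrite openE => /(_ _ Wxy).
  case=> -[/= U V] [/nbhs_ballP[e1 /= e10 xU] /nbhs_ballP[e2 /= e20 yV]] UVW.
  pose e := Num.min e1 e2.
  have e0 : 0 < e by rewrite lt_min e10.
  have [r /andP[r0 re]] : exists r : rat, (0 : R) < ratr r < e / 2.
    have [|r] := @rat_in_itvoo R 0 (e / 2); first by rewrite divr_gt0.
    by rewrite in_itv/= => ?; exists r.
  have app t : exists q : rat, ball t (ratr r) (ratr q : R).
    have [|q] := @rat_in_itvoo R (t - ratr r) (t + ratr r).
      by rewrite ltrD2l gtrN.
    by exists q; rewrite ball_itv.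
  have [p xp] := app x; have [q yq] := app y.
  have sub t s (u : R) e' : e <= e' -> ball t (ratr r) s -> ball s (ratr r) u ->
      ball t e' u.
    move=> ee' ts su; apply: (le_ball ee'); rewrite (splitr e).
    have ts' := le_ball (ltW re) ts.
    have su' := le_ball (ltW re) su.
    exact: (ball_triangle ts' su').
  exists (p, q, r); last by split=> /=; exact: ball_sym.
  move=> [a b] [/= pa qb]; apply: UVW; split.
    by apply: xU; apply: sub xp pa; rewrite ge_min lexx.
  by apply: yV; apply: sub yq qb; rewrite ge_min lexx orbT.
rewrite bigcup_mkcond; apply: countable_bigcupT_measurable; first exact: countableP.
move=> q; case: ifPn => // _.
by apply: measurableX; exact: measurable_ball.
Qed.

Lemma measurable_circle_coord : measurable_fun setT circle_coord.
Proof.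
have mo (f : circle -> R) : continuous f -> measurable_fun setT f.
  move=> /continuousP cf; apply: (measurability _ (RGenOpens.measurableE R)).
  move=> _ [_ [a [b ->]] <-]; rewrite setTI.
  by apply: sub_sigma_algebra; apply: cf; exact: interval_open.
have cc : continuous circle_coord by exact: initial_continuous.
apply/measurable_fun_pairP; split; apply: mo => z.
  by apply: continuous_comp; [exact: cc|exact: cvg_fst].
by apply: continuous_comp; [exact: cc|exact: cvg_snd].
Qed.

Lemma measurable_circle_mul :
  measurable_fun setT (fun zw : circle * circle => circle_mul zw.1 zw.2).
Proof.

have mE : @measurable _ circle = <<s @open circle >> by [].
apply: (measurability _ mE).
move=> _ [B [W oW <-] <-]; rewrite setTI.
rewrite -comp_preimage.
have mc : measurable_fun setT (fun zw : circle * circle =>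
    (circle_coord zw.1, circle_coord zw.2)).
  by apply: measurable_fun_pair; apply: measurableT_comp => //;
    exact: measurable_circle_coord.
have m11 := measurableT_comp measurable_fst (measurableT_comp measurable_fst mc).
have m12 := measurableT_comp measurable_snd (measurableT_comp measurable_fst mc).
have m21 := measurableT_comp measurable_fst (measurableT_comp measurable_snd mc).
have m22 := measurableT_comp measurable_snd (measurableT_comp measurable_snd mc).
suff mh : measurable_fun setT (circle_coord \o
    (fun zw : circle * circle => circle_mul zw.1 zw.2)).
  by rewrite -[X in measurable X]setTI; apply: mh => //; exact: open_measurable_prod.
rewrite [X in measurable_fun _ X](_ : _ = (fun zw : circle * circle =>
  (complex.Re zw.1 * complex.Re zw.2 - complex.Im zw.1 * complex.Im zw.2,
   complex.Re zw.1 * complex.Im zw.2 + complex.Im zw.1 * complex.Re zw.2))).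
  apply: measurable_fun_pair.
    by apply: measurable_funB; exact: measurable_funM.
  by apply: measurable_funD; exact: measurable_funM.
by apply/funext => -[[[a b] ?] [[c d] ?]].
Qed.
End Circle.

Section Convolution.
Variable R : realType.
Local Notation finmeas := {finite_measure set circle R -> \bar R}.

Section convolution_measure.
Variables mu nu : finmeas.

Definition convolution : set (circle R) -> \bar R :=
  pushforward (mu \x nu)%E (fun zw => circle_mul zw.1 zw.2).

Let convolution0 : convolution set0 = 0%E.
Proof. by rewrite /convolution /pushforward preimage_set0 measure0. Qed.

Let convolution_ge0 A : (0 <= convolution A)%E.
Proof. by rewrite /convolution /pushforward; exact: measure_ge0. Qed.

Let convolution_sigma_additive : semi_sigma_additive convolution.
Proof.
have mm := @measurable_circle_mul R.
exact: measure_semi_sigma_additive.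
Qed.

HB.instance Definition _ := isMeasure.Build _ _ _ convolution
  convolution0 convolution_ge0 convolution_sigma_additive.

Let convolution_fin_num : fin_num_fun convolution.
Proof.
move=> A mA.
rewrite ge0_fin_numE; last exact: convolution_ge0.
apply: (@le_lt_trans _ _ (convolution setT)).
  by apply: le_measure; rewrite ?inE.
rewrite /convolution /pushforward preimage_setT -setXTT product_measure1E//.
by rewrite -ge0_fin_numE ?mule_ge0// fin_numM ?fin_num_measure.
Qed.

HB.instance Definition _ := Measure_isFinite.Build _ _ _ convolution
  convolution_fin_num.

End convolution_measure.

Definition conv (mu nu : finmeas) : finmeas := convolution mu nu.

(* nu_0 * ... * nu_(n-1); the Dirac mass at 1 is the unit of convolution. *)
Definition conv_seq n (nu : 'I_n -> finmeas) : finmeas :=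
  \big[conv/(dirac (circle1 R) : finmeas)]_(i < n) nu i.

Definition conv_pow (mu : finmeas) k : finmeas := conv_seq (fun _ : 'I_k => mu).

Definition continuous_measure (mu : finmeas) : Prop :=
  forall z : circle R, mu [set z] = 0%E.

Definition mutually_singular (mu nu : finmeas) : Prop :=
  exists N : set (circle R), [/\ measurable N, mu N = 0%E & nu (~` N) = 0%E].

Definition CS n (tau : finmeas) : Prop :=
  forall nu : 'I_n -> finmeas, (forall i, continuous_measure (nu i)) ->
    mutually_singular tau (conv_seq nu).

End Convolution.

Section L2.
Context d (T : measurableType d) (R : realType).
Variable mu : {measure set T -> \bar R}.
Local Notation C := R[i].

(* Measurable f : T -> C with |f|^2 = (Re f)^2 + (Im f)^2 integrable. *)
Definition sqintegrable : {pred T -> C} := fun f =>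
  ((fun x => complex.Re (f x)) \in Lfun mu 2%:E) &&
  ((fun x => complex.Im (f x)) \in Lfun mu 2%:E).

Lemma sqintegrableZD (a : C) (f g : T -> C) :
  f \in sqintegrable -> g \in sqintegrable ->
  (fun x => a * f x + g x) \in sqintegrable.
Proof.
have le12 : (1 <= 2%:E :> \bar R)%E by rewrite lee_fin ler1n.
move=> /andP[fr fi] /andP[gr gi]; apply/andP; split.
  rewrite [X in X \in _](_ : _ = complex.Re a *: (fun x => complex.Re (f x))
    + ((- complex.Im a) *: (fun x => complex.Im (f x)) + (fun x => complex.Re (g x)))).
    have [_ H] := Lfun_submod_closed mu le12.
    by apply: (H (complex.Re a)) => //; apply: (H (- complex.Im a)).
  apply/funext => x; rewrite !fctE.
  by case: a (f x) (g x) => [a b] [c e] [h k]; rewrite /GRing.scale /= mulNr addrA.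
rewrite [X in X \in _](_ : _ = complex.Re a *: (fun x => complex.Im (f x))
    + (complex.Im a *: (fun x => complex.Re (f x)) + (fun x => complex.Im (g x)))).
  have [_ H] := Lfun_submod_closed mu le12.
  by apply: (H (complex.Re a)) => //; apply: (H (complex.Im a)).
apply/funext => x; rewrite !fctE.
by case: a (f x) (g x) => [a b] [c e] [h k]; rewrite /GRing.scale /= addrA.
Qed.

Lemma sqintegrable0 : (0 : T -> C) \in sqintegrable.
Proof.
have le12 : (1 <= 2%:E :> \bar R)%E by rewrite lee_fin ler1n.
by have [H _] := Lfun_submod_closed mu le12; apply/andP; split; exact: H.
Qed.

Lemma sqintegrable_zmod_closed : zmod_closed sqintegrable.
Proof.
split; first exact: sqintegrable0.
move=> f g fL gL.
rewrite (_ : f - g = (fun x => -1 * g x + f x)); first exact: sqintegrableZD.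
by apply/funext => x; rewrite mulN1r addrC.
Qed.

HB.instance Definition _ := GRing.isZmodClosed.Build (T -> C) sqintegrable
  sqintegrable_zmod_closed.

Record L2fun := MkL2fun { L2fun_val :> T -> C; _ : L2fun_val \in sqintegrable }.

HB.instance Definition _ := [isSub for L2fun_val].
HB.instance Definition _ := [Choice of L2fun by <:].
HB.instance Definition _ := [SubChoice_isSubZmodule of L2fun by <:].

Definition L2null : {pred L2fun} := fun f => `[< {ae mu, forall x, f x = 0} >].

Lemma L2null_zmod_closed : zmod_closed L2null.
Proof.
split; first by apply/asboolP; apply: aeW.
move=> f g /asboolP f0 /asboolP g0; apply/asboolP.
by move: f0 g0; apply: filterS2 => x /= fx gx; rewrite !fctE fx gx subrr.
Qed.

HB.instance Definition _ := GRing.isZmodClosed.Build L2fun L2null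
  L2null_zmod_closed.

Definition L2 := Quotient.quot L2null.

HB.instance Definition _ := GRing.Zmodule.on L2.
HB.instance Definition _ := EqQuotient.on L2.

Definition L2class (f : L2fun) : L2 := \pi_L2 f.

Lemma L2classP (f g : L2fun) :
  L2class f = L2class g <-> {ae mu, forall x, f x = g x}.
Proof.
split.
  move=> /eqP; rewrite -Quotient.idealrBE => /asboolP; apply: filterS => x /=.
  by rewrite !fctE => /eqP; rewrite subr_eq0 => /eqP.
move=> fg; apply/eqP; rewrite -Quotient.idealrBE; apply/asboolP.
by move: fg; apply: filterS => x /= fg; rewrite !fctE fg subrr.
Qed.

Lemma L2class_repr (u : L2) : L2class (repr u) = u.
Proof. exact: reprK. Qed.

Lemma L2classD (f g : L2fun) : L2class (f + g) = L2class f + L2class g.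
Proof. by rewrite /L2class !piE. Qed.

Lemma L2fun_scale_subproof (a : C) (f : L2fun) :
  (fun x => a * f x) \in sqintegrable.
Proof.
have := sqintegrableZD a (valP f) sqintegrable0.
by rewrite (_ : (fun x => _ + _) = (fun x => a * f x))//; apply/funext => x; rewrite addr0.
Qed.
Definition L2fun_scale (a : C) (f : L2fun) : L2fun := MkL2fun (L2fun_scale_subproof a f).

Definition L2scale (a : C) (u : L2) : L2 := L2class (L2fun_scale a (repr u)).

Lemma L2scale_class a (f : L2fun) : L2scale a (L2class f) = L2class (L2fun_scale a f).
Proof.
apply/L2classP; have /L2classP := L2class_repr (L2class f).
by apply: filterS => x /= ->.
Qed.

Let L2scaleA a b u : L2scale a (L2scale b u) = L2scale (a * b) u.
Proof.
rewrite -(L2class_repr u) !L2scale_class; congr L2class.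
by apply/val_inj/funext => x /=; rewrite mulrA.
Qed.

Let L2scale1 : left_id 1 L2scale.
Proof.
move=> u; rewrite -(L2class_repr u) !L2scale_class; congr L2class.
by apply/val_inj/funext => x /=; rewrite mul1r.
Qed.

Let L2scaleDr : right_distributive L2scale +%R.
Proof.
move=> a u v; rewrite -(L2class_repr u) -(L2class_repr v).
rewrite -L2classD !L2scale_class -L2classD; congr L2class.
by apply/val_inj/funext => x /=; rewrite !fctE mulrDr.
Qed.

Let L2scaleDl v : {morph L2scale^~ v : a b / a + b}.
Proof.
move=> a b; rewrite -(L2class_repr v) !L2scale_class -L2classD; congr L2class.
by apply/val_inj/funext => x /=; rewrite !fctE mulrDl.
Qed.

HB.instance Definition _ := GRing.Zmodule_isLmodule.Build C L2
  L2scaleA L2scale1 L2scaleDr L2scaleDl.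

Definition Cintegral (f : T -> C) : C :=
  Complex (\int[mu]_x complex.Re (f x))%R (\int[mu]_x complex.Im (f x))%R.

Definition L2inner (u v : L2) : C :=
  Cintegral (fun x => (repr u : L2fun) x * ((repr v : L2fun) x)^*).

Let Cintegrable (f : T -> C) :=
  mu.-integrable setT (EFin \o (fun x => complex.Re (f x))) /\
  mu.-integrable setT (EFin \o (fun x => complex.Im (f x))).

Let CintegralZD (a : C) (f g : T -> C) : Cintegrable f -> Cintegrable g ->
  Cintegral (fun x => a * f x + g x) = a * Cintegral f + Cintegral g.
Proof.
move=> [f1 f2] [g1 g2]; case: a => a b.
have iZ (c : R) (h : T -> R) : mu.-integrable setT (EFin \o h) ->
    mu.-integrable setT (EFin \o (fun x => c * h x)).
  by move=> ih; apply: (@eq_integrable _ _ _ mu _ measurableT _ _ _ (integrableZl measurableT c ih)).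
have iB (h k : T -> R) : mu.-integrable setT (EFin \o h) ->
    mu.-integrable setT (EFin \o k) ->
    mu.-integrable setT (EFin \o (fun x => h x - k x)).
  by move=> ih ik; apply: (@eq_integrable _ _ _ mu _ measurableT _ _ _ (integrableB measurableT ih ik)).
have iD (h k : T -> R) : mu.-integrable setT (EFin \o h) ->
    mu.-integrable setT (EFin \o k) ->
    mu.-integrable setT (EFin \o (fun x => h x + k x)).
  by move=> ih ik; apply: (@eq_integrable _ _ _ mu _ measurableT _ _ _ (integrableD measurableT ih ik)).
rewrite /Cintegral; set I := fun h : T -> R => \int[mu]_x h x.
have -> : Complex a b * Complex (I (fun x => complex.Re (f x)))
      (I (fun x => complex.Im (f x))) +
    Complex (I (fun x => complex.Re (g x))) (I (fun x => complex.Im (g x))) =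
    Complex (a * I (fun x => complex.Re (f x)) - b * I (fun x => complex.Im (f x))
             + I (fun x => complex.Re (g x)))
            (a * I (fun x => complex.Im (f x)) + b * I (fun x => complex.Re (f x))
             + I (fun x => complex.Im (g x))) by [].
rewrite /I -!RintegralZl// -RintegralB ?iZ// -!RintegralD ?iZ ?iB ?iD ?iZ//.
by congr Complex; apply: eq_Rintegral => x _; case: (f x) (g x) => [? ?] [].
Qed.

Let Cintegral_conj (f : T -> C) : Cintegrable f ->
  Cintegral (fun x => (f x)^*) = (Cintegral f)^*.
Proof.
move=> [_ f2]; rewrite /Cintegral -[RHS]/(Complex _ (- _)); congr Complex.
  by apply: eq_Rintegral => x _; case: (f x).
rewrite -mulN1r -RintegralZl//.
by apply: eq_Rintegral => x _; case: (f x) => ? ?; rewrite mulN1r.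
Qed.

Let Cintegrable_mul (f g : L2fun) : Cintegrable (fun x => f x * (g x)^*).
Proof.
have /andP[f1 f2] := valP f; have /andP[g1 g2] := valP g.
have M (h k : T -> R) : h \in Lfun mu 2%:E -> k \in Lfun mu 2%:E ->
    mu.-integrable setT (EFin \o (h \* k)).
  by move=> hL kL; apply/Lfun1_integrable; exact: Lfun2_mul_Lfun1.
split.
  apply: (@eq_integrable _ _ _ mu _ measurableT _ _ _ (integrableD measurableT (M _ _ f1 g1) (M _ _ f2 g2))) => //.
  by move=> x _ /=; case: (f x) (g x) => [a b] [c e] /=; rewrite mulrN opprK.
apply: (@eq_integrable _ _ _ mu _ measurableT _ _ _ (integrableB measurableT (M _ _ f2 g1) (M _ _ f1 g2))) => //.
by move=> x _ /=; case: (f x) (g x) => [a b] [c e] /=; rewrite mulrN addrC.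
Qed.

Lemma L2inner_class (f g : L2fun) :
  L2inner (L2class f) (L2class g) = Cintegral (fun x => f x * (g x)^*).
Proof.
have /L2classP rf := L2class_repr (L2class f).
have /L2classP rg := L2class_repr (L2class g).
have [a1 a2] := Cintegrable_mul (repr (L2class f)) (repr (L2class g)).
have [b1 b2] := Cintegrable_mul f g.
have h : {ae mu, forall x, repr (L2class f) x * (repr (L2class g) x)^* =
    f x * (g x)^*}.
  by apply: (filterS2 _ _ rf rg) => x -> ->.
rewrite /L2inner /Cintegral /Rintegral; congr Complex; congr fine.
  apply: ae_eq_integral; [by []|exact: measurable_int a1|exact: measurable_int b1|].
  by apply: (filterS _ h) => x /= ->.
apply: ae_eq_integral; [by []|exact: measurable_int a2|exact: measurable_int b2|].
by apply: (filterS _ h) => x /= ->.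
Qed.

Let L2inner_linearl v : linear_for *%R (L2inner^~ v).
Proof.
move=> a u w; rewrite -(L2class_repr u) -(L2class_repr v) -(L2class_repr w).
rewrite -[a *: _]/(L2scale _ _) L2scale_class -L2classD !L2inner_class.
rewrite -CintegralZD; try exact: Cintegrable_mul.
by congr Cintegral; apply/funext => x /=; rewrite !fctE mulrDl mulrA.
Qed.

Let L2inner_herm u v : L2inner u v = (-1) ^+ false * (L2inner v u)^*.
Proof.
rewrite expr0 mul1r -(L2class_repr u) -(L2class_repr v) !L2inner_class.
rewrite -Cintegral_conj; last exact: Cintegrable_mul.
by congr Cintegral; apply/funext => x /=; rewrite rmorphM/= conjCK mulrC.
Qed.

Let L2inner_bilinear : bilinear_for *%R (Num.conj \; *%R) L2inner.
Proof.
split=> u; first exact: L2inner_linearl.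
move=> a v w /=; rewrite L2inner_herm L2inner_linearl expr0 mul1r.
rewrite rmorphD rmorphM /=.
by rewrite [L2inner u v]L2inner_herm [L2inner u w]L2inner_herm !expr0 !mul1r.
Qed.

HB.instance Definition _ := bilinear_isBilinear.Build C L2 L2 C *%R
  (Num.conj \; *%R) L2inner L2inner_bilinear.
HB.instance Definition _ := isHermitianSesquilinear.Build C L2 false Num.conj
  L2inner L2inner_herm.

Let L2inner_gt0 u : u != 0 -> 0 < L2inner u u.
Proof.
move=> u0; have [/integrableP[m1 _] _] := Cintegrable_mul (repr u) (repr u).
set f : L2fun := repr u in m1.
pose N x : R := complex.Re (f x) ^+ 2 + complex.Im (f x) ^+ 2.
have NE : (fun x => complex.Re (f x * (f x)^*)) = N.
  by apply/funext => x; rewrite /N; case: (f x) => a b /=; rewrite mulrN opprK.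
have N0 x : 0 <= N x by rewrite addr_ge0 ?sqr_ge0.
rewrite lt_def; apply/andP; split; last first.
  rewrite lecE; apply/andP; split.
    apply/eqP; rewrite /L2inner /= /Rintegral integral0_eq// => x _.
    by rewrite -/f; case: (f x) => a b /=; rewrite mulrN mulrC addNr.
  rewrite /L2inner /= -/f NE.
  by apply: (@Rintegral_ge0 _ _ _ mu setT N) => x _; exact: N0.
apply: contra u0 => /eqP/(congr1 (@complex.Re R)); rewrite /L2inner /= -/f NE => I0.
rewrite NE in m1.
have IE0 : (\int[mu]_x (N x)%:E = 0)%E.
  have [/integrableP[_ fi] _] := Cintegrable_mul f f.
  rewrite NE in fi.
  rewrite -[LHS]fineK; first by rewrite -[fine _]/(Rintegral mu setT N) I0.
  rewrite ge0_fin_numE ?integral_ge0//; last by move=> x _; rewrite lee_fin.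
  by apply: le_lt_trans fi; apply: ge0_le_integral => //;
    [move=> x _; rewrite lee_fin|exact: measurableT_comp|
     move=> x _; rewrite /= lee_fin ler_norm].
have : (\int[mu]_x `|(EFin \o N) x| = 0)%E.
  by rewrite -IE0; apply: eq_integral => x _; rewrite /= ger0_norm.
move=> /(ae_eq_integral_abs _ measurableT m1) f0.
apply/eqP; rewrite -(L2class_repr u).
have -> : (0 : L2) = L2class 0 by rewrite /L2class -[RHS]/(\pi_L2 _) !piE.
apply/L2classP; apply: (filterS _ f0) => x /= /(_ I)[].
rewrite /N -/f; case: (f x) => a b /= /eqP.
by rewrite paddr_eq0 ?sqr_ge0// !sqrf_eq0 => /andP[/eqP-> /eqP->].
Qed.


HB.instance Definition _ := isDotProduct.Build C L2 L2inner L2inner_gt0.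


Section multiplication.
Variable h : T -> C.
Hypothesis mRe : measurable_fun setT (fun x => complex.Re (h x)).
Hypothesis mIm : measurable_fun setT (fun x => complex.Im (h x)).
Hypothesis h1 : forall x, `|h x| = 1.

Let Lfun2_mul (k f : T -> R) : measurable_fun setT k -> (forall x, `|k x| <= 1) ->
  f \in Lfun mu 2%:E -> (k \* f) \in Lfun mu 2%:E.
Proof.
move=> mk k1 /andP[/[!inE]/= mf lf]; apply/andP; split.
  by rewrite inE/=; exact: measurable_funM.
rewrite inE/= /finite_norm; apply: le_lt_trans lf; rewrite unlock.
rewrite gt0_ler_poweR//; do 1? by rewrite in_itv/= leey integral_ge0.
have m2 (f' : T -> R) : measurable_fun setT f' ->
    measurable_fun setT (fun x => (`|(EFin \o f') x| `^ 2)%E).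
  move=> mf'.
  apply/measurable_EFinP/(@measurableT_comp _ _ _ _ _ _ (fun x : R => x `^ 2)) => //.
  exact: measurableT_comp.
apply: ge0_le_integral => //.
- by move=> x _; exact: poweR_ge0.
- by apply: (m2 (k \* f)); exact: measurable_funM.
- exact: m2.
move=> x _ /=; rewrite lee_fin !powR_mulrn//.
by rewrite ler_pXn2r ?nnegrE// normrM ler_piMl.
Qed.

Let h1E x : complex.Re (h x) ^+ 2 + complex.Im (h x) ^+ 2 = 1.
Proof.
have := h1 x; case: (h x) => a b [] /(congr1 (fun x => x ^+ 2)).
by rewrite expr1n sqr_sqrtr// addr_ge0 ?sqr_ge0.
Qed.

Lemma L2fun_mul_subproof (f : L2fun) : (fun x => h x * f x) \in sqintegrable.
Proof.
have hr x : `|complex.Re (h x)| <= 1.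
  rewrite -(@ler_pXn2r _ 2) ?nnegrE// expr1n real_normK ?num_real//.
  by rewrite -(h1E x) lerDl sqr_ge0.
have hi x : `|complex.Im (h x)| <= 1.
  rewrite -(@ler_pXn2r _ 2) ?nnegrE// expr1n real_normK ?num_real//.
  by rewrite -(h1E x) lerDr sqr_ge0.
have le12 : (1 <= 2%:E :> \bar R)%E by rewrite lee_fin ler1n.
have [_ S] := Lfun_submod_closed mu le12.
have /andP[fr fi] := valP f; apply/andP; split.
  rewrite (_ : (fun x => _) = -1 *: ((fun x => complex.Im (h x)) \*
    (fun x => complex.Im (f x))) + ((fun x => complex.Re (h x)) \*
    (fun x => complex.Re (f x)))).
    exact: S (Lfun2_mul mIm hi fi) (Lfun2_mul mRe hr fr).
  apply/funext => x; rewrite !fctE scaleN1r addrC.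
  by move=> /=; case: (h x) (f x) => [a b] [c e].
rewrite (_ : (fun x => _) = 1 *: ((fun x => complex.Im (h x)) \*
    (fun x => complex.Re (f x))) + ((fun x => complex.Re (h x)) \*
    (fun x => complex.Im (f x)))).
  exact: S (Lfun2_mul mIm hi fr) (Lfun2_mul mRe hr fi).
apply/funext => x; rewrite !fctE scale1r addrC.
by move=> /=; case: (h x) (f x) => [a b] [c e].
Qed.

Definition L2fun_mul (f : L2fun) : L2fun := MkL2fun (L2fun_mul_subproof f).

Definition L2mul (u : L2) : L2 := L2class (L2fun_mul (repr u)).

Lemma L2mul_class f : L2mul (L2class f) = L2class (L2fun_mul f).
Proof.
apply/L2classP; have /L2classP := L2class_repr (L2class f).
by apply: filterS => x /= ->.
Qed.

Lemma L2mul_linear : linear L2mul.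
Proof.
move=> a u v; rewrite -(L2class_repr u) -(L2class_repr v).
rewrite -[a *: L2class _]/(L2scale _ _) L2scale_class -L2classD !L2mul_class.
rewrite -[a *: L2class _]/(L2scale _ _) L2scale_class -L2classD.
by congr L2class; apply/val_inj/funext => x /=; rewrite !fctE/= mulrDr mulrCA.
Qed.

Lemma L2mul_inner u v : L2inner (L2mul u) (L2mul v) = L2inner u v.
Proof.
rewrite -(L2class_repr u) -(L2class_repr v) !L2mul_class !L2inner_class.
congr Cintegral; apply/funext => x /=.
by rewrite rmorphM/= mulrACA -normCK h1 expr1n mul1r.
Qed.

End multiplication.

Lemma L2mul_surj (h : T -> C) (mRe : measurable_fun setT (fun x => complex.Re (h x)))
   (mIm : measurable_fun setT (fun x => complex.Im (h x)))
   (h1 : forall x, `|h x| = 1) v : exists u, L2mul mRe mIm h1 u = v.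
Proof.
have mRe' : measurable_fun setT (fun x => complex.Re (h x)^*).
  by apply: eq_measurable_fun mRe => x _; case: (h x).
have mIm' : measurable_fun setT (fun x => complex.Im (h x)^*).
  apply: eq_measurable_fun (measurableT_comp (@oppr_measurable R setT) mIm) => x _ /=.
  by case: (h x).
have h1' x : `|(h x)^*| = 1 by rewrite norm_conjC.
exists (L2mul mRe' mIm' h1' v); rewrite -(L2class_repr v) !L2mul_class.
congr L2class; apply/val_inj/funext => x /=.
by rewrite mulrA -normCK h1 expr1n mul1r.
Qed.

End L2.

Section InnerProductSpaces.
Variable R : realType.

Record innerProductSpace := InnerProductSpace {
  ips_sort :> lmodType R[i];
  dotp : {dot ips_sort for (@Num.conj R[i])} }.

Section defs.
Variable H : innerProductSpace.

Definition ips_norm (u : H) : R := Num.sqrt (complex.Re (dotp H u u)).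

Definition ips_complete := forall u : nat -> H,
  (forall e, 0 < e -> exists N, forall m n, (N <= m)%N -> (N <= n)%N ->
     ips_norm (u m - u n) < e) ->
  exists l, forall e, 0 < e -> exists N, forall n, (N <= n)%N ->
     ips_norm (u n - l) < e.

Definition closed_span (A : set H) : set H :=
  [set w | forall e : R, 0 < e ->
     exists (m : nat) (c : 'I_m -> R[i]) (a : 'I_m -> H),
       (forall j, A (a j)) /\ ips_norm (w - \sum_(j < m) c j *: a j) < e].

Definition bounded_op (A : H -> H) : Prop :=
  linear A /\ exists M : R, forall u, ips_norm (A u) <= M * ips_norm u.

Record unitary := Unitary {
  unitary_fun :> H -> H;
  unitary_linear : linear unitary_fun;
  unitary_dotp : forall u v, dotp H (unitary_fun u) (unitary_fun v) = dotp H u v;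
  unitary_surj : forall v, exists u, unitary_fun u = v }.

(* The restriction of the bijection U to S has a cyclic vector v: the closed span
   of {U^k v | k in Z} is S. The vectors w = U^m v and w = U^(-m) v are described
   by equations, so as not to mention the inverse of U. *)
Definition simple_spectrum (S : set H) (U : H -> H) : Prop :=
  exists2 v, S v & S `<=` closed_span
    [set w | S w /\ exists m : nat, w = iter m U v \/ iter m U w = v].

Lemma dotp_real u : dotp H u u = (complex.Re (dotp H u u))%:C%C.
Proof.
have := dnorm_ge0 (dotp H) u; rewrite lecE => /andP[/eqP].
by case: (dotp H u u) => a b /= ->.
Qed.

Lemma Re_dotp_ge0 u : 0 <= complex.Re (dotp H u u).
Proof. by have := dnorm_ge0 (dotp H) u; rewrite lecE => /andP[]. Qed.

Lemma ips_norm_ge0 u : 0 <= ips_norm u.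
Proof. exact: sqrtr_ge0. Qed.

Lemma ips_norm_sqr u : ips_norm u ^+ 2 = complex.Re (dotp H u u).
Proof. by rewrite sqr_sqrtr// Re_dotp_ge0. Qed.

Lemma ips_norm0 : ips_norm 0 = 0.
Proof. by rewrite /ips_norm linear0l sqrtr0. Qed.

Lemma ips_norm_eq0 u : ips_norm u = 0 -> u = 0.
Proof.
move=> u0; apply/eqP; rewrite -(dnorm_eq0 (dotp H)) dotp_real -ips_norm_sqr u0.
by rewrite expr0n.
Qed.

(* The factor 2 is not optimal, but suffices below. *)
Lemma ips_normD u v : ips_norm (u + v) <= 2 * (ips_norm u + ips_norm v).
Proof.
rewrite -(@ler_pXn2r _ 2) ?nnegrE ?mulr_ge0 ?addr_ge0 ?ips_norm_ge0//.
have par : ips_norm (u + v) ^+ 2 + ips_norm (u - v) ^+ 2 =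
    2 * (ips_norm u ^+ 2 + ips_norm v ^+ 2).
  rewrite !ips_norm_sqr dnormD dnormB.
  by case: (dotp H u u) (dotp H v v) (dotp H u v) => [a b] [c e] [f g] /=; ring.
have := sqr_ge0 (ips_norm (u - v)); have := ips_norm_ge0 u.
have := ips_norm_ge0 v; nra.
Qed.

Lemma ips_normN u : ips_norm (- u) = ips_norm u.
Proof. by rewrite /ips_norm linearNl linearNr opprK. Qed.

Lemma ips_normB u v : ips_norm (u - v) <= 2 * (ips_norm u + ips_norm v).
Proof. by rewrite -(ips_normN v); exact: ips_normD. Qed.

Lemma ips_normZ a : exists2 M : R, 0 < M & forall u, ips_norm (a *: u) <= M * ips_norm u.
Proof.
exists (complex.Re `|a| + 1).
  by rewrite ltr_wpDl// -[0]/(complex.Re 0); case/andP: (normr_ge0 a).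
move=> u.
have M0 : 0 <= complex.Re `|a| by case/andP: (normr_ge0 a).
rewrite -(@ler_pXn2r _ 2) ?nnegrE ?mulr_ge0 ?addr_ge0 ?ips_norm_ge0//.
rewrite exprMn !ips_norm_sqr dnormZ.
have -> : `|a| = (complex.Re `|a|)%:C%C by case: a {M0} => x y.
rewrite dotp_real -rmorphXn -rmorphM /=.
by rewrite ler_wpM2r ?Re_dotp_ge0// ler_pXn2r ?nnegrE ?addr_ge0// lerDl.
Qed.

End defs.

Record hilbertSpace := HilbertSpace {
  hs_ips :> innerProductSpace;
  hs_complete : ips_complete hs_ips }.

Section TensorPower.
Variables (H : innerProductSpace) (n : nat).

(* The n-th Hilbert tensor power of H: a Hilbert space K with elementary tensors
   satisfying <x_1 (x) ... (x) x_n, y_1 (x) ... (x) y_n> = <x_1, y_1> ... <x_n, y_n>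
   and spanning a dense subspace; this determines K up to a unique unitary
   compatible with the elementary tensors. *)
Record tensorPower := TensorPower {
  tp_space :> hilbertSpace;
  tens : ('I_n -> H) -> tp_space;
  tens_linear : forall (i : 'I_n) (x : 'I_n -> H),
    linear (fun u => tens (fun j => if j == i then u else x j));
  tens_dotp : forall x y : 'I_n -> H,
    dotp tp_space (tens x) (tens y) = \prod_(i < n) dotp H (x i) (y i);
  tens_total : closed_span (range tens) = setT }.

Variable K : tensorPower.

(* The bounded operators A on K with A (x_1 (x) ... (x) x_n) =
   g(x)_1 (x) ... (x) g(x)_n. There is at most one, and exactly one if g
   preserves the products of inner products: see tens_liftP and lifts_uniq. *)
Definition lifts (g : ('I_n -> H) -> ('I_n -> H)) : set (K -> K) :=
  [set A | bounded_op A /\ forall x, A (tens K x) = tens K (g x)].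

Definition tens_lift g : K -> K := xget (id : K -> K) (lifts g).

Section tens_lift_exists.
Variable g : ('I_n -> H) -> ('I_n -> H).
Hypothesis gP : forall x y,
  \prod_(i < n) dotp H (g x i) (g y i) = \prod_(i < n) dotp H (x i) (y i).

Let comb (h : ('I_n -> H) -> ('I_n -> H)) (s : seq (R[i] * ('I_n -> H))) : K :=
  \sum_(p <- s) p.1 *: tens K (h p.2).

Let comb_dotp s : dotp K (comb g s) (comb g s) = dotp K (comb id s) (comb id s).
Proof.
rewrite /comb !linear_sumlz; apply: eq_bigr => p _.
rewrite !linear_sumr; apply: eq_bigr => q _.
by rewrite !linearZl_LR !linearZr_LR/= !tens_dotp gP.
Qed.

Let comb_norm s : ips_norm (comb g s) = ips_norm (comb id s).
Proof. by rewrite /ips_norm comb_dotp. Qed.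

Let combZD h a s t :
  comb h ([seq (a * p.1, p.2) | p <- s] ++ t) = a *: comb h s + comb h t.
Proof.
rewrite /comb big_cat big_map/=; congr (_ + _).
by rewrite scaler_sumr; apply: eq_bigr => p _; rewrite scalerA.
Qed.

Let comb_dense v e : 0 < e -> exists s, ips_norm (v - comb id s) < e.
Proof.
move=> e0; have : closed_span (range (tens K)) v by rewrite tens_total.
move=> /(_ _ e0)[m [c [a [aP ve]]]].
have /choice[x xP] : forall j, exists x, tens K x = a j.
  by move=> j; have [x _ <-] := aP j; exists x.
exists [seq (c j, x j) | j <- enum 'I_m]; rewrite /comb big_map big_enum/=.
by under eq_bigr do rewrite xP.
Qed.

Let graph v w := forall e, 0 < e ->
  exists s, ips_norm (v - comb id s) < e /\ ips_norm (w - comb g s) < e.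

Let graph_norm v w : graph v w -> ips_norm w <= 4 * ips_norm v.
Proof.
move=> G; apply/ler_addgt0Pr => e e0.
have [|s [vs ws]] := G (e / 6); first by rewrite divr_gt0.
have h1 : ips_norm w <= 2 * (ips_norm (w - comb g s) + ips_norm (comb g s)).
  by rewrite -[in leLHS](subrK (comb g s) w) ips_normD.
have h2 : ips_norm (comb id s) <= 2 * (ips_norm v + ips_norm (v - comb id s)).
  by rewrite (le_trans _ (ips_normB _ _))// subKr.
by rewrite comb_norm in h1; lra.
Qed.

Let graphZD a v w v' w' : graph v w -> graph v' w' ->
  graph (a *: v + v') (a *: w + w').
Proof.
move=> G G' e e0; have [M M0 MP] := ips_normZ K a.
have [|s [vs ws]] := G (e / (4 * M)); first by rewrite divr_gt0// mulr_gt0.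
have [|t [vt wt]] := G' (e / 4); first by rewrite divr_gt0.
exists ([seq (a * p.1, p.2) | p <- s] ++ t); rewrite !combZD.
have H1 (x y p q : K) : ips_norm (x - p) < e / (4 * M) -> ips_norm (y - q) < e / 4 ->
    ips_norm (a *: x + y - (a *: p + q)) < e.
  move=> xp yq; rewrite opprD addrACA -scalerBr.
  apply: le_lt_trans (ips_normD _ _) _.
  have := MP (x - p); have : M * ips_norm (x - p) < e / 4.
    by rewrite mulrC -ltr_pdivlMr// (lt_le_trans xp)// invfM mulrA.
  lra.
by split; exact: H1.
Qed.

Let graph_fun v w w' : graph v w -> graph v w' -> w = w'.
Proof.
move=> G G'; have := graphZD (-1) G G'; rewrite !scaleN1r addNr => /graph_norm.
rewrite ips_norm0 mulr0 => h; apply/esym/eqP; rewrite -subr_eq0 addrC; apply/eqP.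
by apply: ips_norm_eq0; apply/eqP; rewrite eq_le h ips_norm_ge0.
Qed.

Let graph_total v : exists w, graph v w.
Proof.
have /choice[s sP] : forall k : nat, exists s, ips_norm (v - comb id s) < k.+1%:R^-1.
  by move=> k; apply: comb_dense; rewrite invr_gt0.
have small e : 0 < e -> exists N : nat, forall k, (N <= k)%N -> k.+1%:R^-1 < e :> R.
  move=> e0; exists (Num.truncn e^-1) => k Nk.
  rewrite invf_plt ?posrE// (lt_le_trans (truncnS_gt _))// ler_nat ltnS//.
have [|w wP] := @hs_complete K (fun k => comb g (s k)).
  move=> e e0; have [|N NP] := small (e / 4); first by rewrite divr_gt0.
  exists N => k l /NP Nk /NP Nl.
  have -> : comb g (s k) - comb g (s l) =
      comb g ([seq (-1 * p.1, p.2) | p <- s l] ++ s k).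
    by rewrite combZD scaleN1r addrC.
  rewrite comb_norm combZD scaleN1r addrC.
  have -> : comb id (s k) - comb id (s l) =
      (v - comb id (s l)) - (v - comb id (s k)).
    by rewrite opprB [RHS]addrC addrA subrK.
  apply: le_lt_trans (ips_normB _ _) _.
  have vk := lt_trans (sP k) Nk; have vl := lt_trans (sP l) Nl.
  by move: vk vl; move: (ips_norm _) (ips_norm _) => x y; lra.
exists w => e e0; have [N NP] := small e e0; have [M MP] := wP e e0.
exists (s (maxn N M)); split.
  by apply: lt_trans (sP _) (NP _ _); rewrite leq_maxl.
by rewrite -ips_normN opprB; apply: MP; rewrite leq_maxr.
Qed.

Lemma tens_liftP : lifts g (tens_lift g).
Proof.
apply: xgetPex; have /choice[A AP] := graph_total.
exists A; split.
  split; first by move=> a u v; exact: graph_fun (AP _) (graphZD _ (AP _) (AP _)).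
  by exists 4 => u; exact: graph_norm.
move=> x; apply: graph_fun (AP _) _ => e e0; exists [:: (1, x)].
by rewrite /comb !big_seq1 !scale1r !subrr ips_norm0.
Qed.

Lemma lifts_uniq A : lifts g A -> A = tens_lift g.
Proof.
have G B : lifts g B -> forall v, graph v (B v).
  move=> [[lB [M MP]] BP] v e e0.
  have [|s vs] := @comb_dense v (e / (`|M| + 1)).
    by rewrite divr_gt0// ltr_wpDl.
  have M1 : 1 <= `|M| + 1 by rewrite lerDr.
  exists s; split.
    apply: lt_le_trans vs _; rewrite ler_pdivrMr; first by rewrite ler_peMr ?(ltW e0).
    by rewrite ltr_wpDl.
  have -> : comb g s = B (comb id s).
    rewrite /comb; elim: s {vs} => [|p s IH]; last by rewrite !big_cons lB BP IH.
    by rewrite !big_nil; have := lB (-1) 0 0; rewrite scaler0 addr0 scaleN1r addNr.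
  have -> : B v - B (comb id s) = B (v - comb id s).
    by rewrite addrC -scaleN1r -lB scaleN1r addrC.
  apply: le_lt_trans (MP _) _.
  rewrite ltr_pdivlMr ?ltr_wpDl// mulrC in vs.
  apply: le_lt_trans vs; rewrite ler_wpM2r ?ips_norm_ge0//.
  by rewrite (le_trans (ler_norm _))// lerDl.
move=> lA; apply/funext => v; exact: graph_fun (G _ lA v) (G _ tens_liftP v).
Qed.

End tens_lift_exists.

Definition tens_unitary (U : unitary H) : K -> K :=
  tens_lift (fun x i => U (x i)).

Definition tens_perm (p : {perm 'I_n}) : K -> K :=
  tens_lift (fun x i => x (p i)).

Lemma tens_unitaryP (U : unitary H) :
  lifts (fun x i => U (x i)) (tens_unitary U).
Proof.
by apply: tens_liftP => x y; apply: eq_bigr => i _; rewrite unitary_dotp.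
Qed.

Lemma tens_permP (p : {perm 'I_n}) : lifts (fun x i => x (p i)) (tens_perm p).
Proof. by apply: tens_liftP => x y; rewrite [RHS](reindex_perm p). Qed.

Definition sym_power : set K := [set v | forall p : {perm 'I_n}, tens_perm p v = v].

End TensorPower.
End InnerProductSpaces.

Arguments lifts {R H n} K g _.
Arguments tens_lift {R H n} K g _.
Arguments tens_unitary {R H n} K U _.
Arguments tens_perm {R H n} K p _.
Arguments sym_power {R H n} K _.

Section Multiplication.
Variable R : realType.
Variable sigma : {finite_measure set circle R -> \bar R}.

Definition L2ips : innerProductSpace R :=
  @InnerProductSpace R (L2 sigma) (@L2inner _ _ R sigma).

Let mRe : measurable_fun setT (fun z : circle R => complex.Re z).
Proof. exact: measurableT_comp measurable_fst (@measurable_circle_coord R). Qed.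

Let mIm : measurable_fun setT (fun z : circle R => complex.Im z).
Proof. exact: measurableT_comp measurable_snd (@measurable_circle_coord R). Qed.

Let h1 (z : circle R) : `|z : R[i]| = 1.
Proof. exact/eqP/circle_valP. Qed.

Definition Vop : unitary L2ips := @Unitary R L2ips
  (@L2mul _ _ R sigma (@circle_val R) mRe mIm h1)
  (@L2mul_linear _ _ _ _ _ mRe mIm h1)
  (@L2mul_inner _ _ _ _ _ mRe mIm h1)
  (@L2mul_surj _ _ _ _ _ mRe mIm h1).

Lemma Vop_class (f : L2fun sigma) :
  exists2 g : L2fun sigma, (forall z, g z = (z : R[i]) * f z) &
    Vop (L2class f) = L2class g.
Proof. by exists (L2fun_mul mRe mIm h1 f); [|exact: L2mul_class]. Qed.

End Multiplication.

(* Main.v *)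
(* If sigma^{*k} is not singular to nu_0 * ... * nu_k, the latter is absolutely
   continuous with respect to sigma^{*k} on some set S which it does not neglect.

   Let V^{(.)N} have simple spectrum. Approximating the elementary symmetric
   functions of the N^k monomials z_{s 1} ... z_{s k} by polynomials in V^{(.)N}
   applied to a cyclic vector shows that they are almost surely functions of
   W = z_1 ... z_N alone. Hence w = z_1 ... z_k is almost surely a root of a monic
   polynomial of degree N^k depending only on W: w takes at most N^k values on a
   fiber of the product map.

   Now write N = nk + r with 0 <= r < k and take points x_{i,l} (i < n, l <= k),
   with x_{i,l} distributed according to nu_l. With positive probability all the
   n^{k+1} products w_phi = prod_l x_{phi l,l} lie in S (Fubini, one variable l at
   a time). They are almost surely distinct, as the nu_l have no atoms. Permuting
   the x_{i,l} for each l separately makes w_phi the product of the first row of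
   the array, without changing the product of all the rows: so all the w_phi lie
   in a single fiber. This is absurd since n^{k+1} > N^k for large N. *)

(* Two points lie behind this sketch. First, the passage from sigma to the nu_l: the bound on fibers
   holds almost surely for points distributed by sigma, while the grid consists of points
   distributed by the nu_l. A row product, restricted to S, has a law absolutely continuous with
   respect to sigma^{*k}. So when all rows lie in S, the pair (first row, product of the other rows)
   avoids the null sets of the product of sigma^{*k} and (sigma^{*k})^{*n}. This is why N is cut
   into blocks of k: a block of k points of sigma stands for a row of k + 1 points of the grid.
   Second, the cyclic vector is only approximated by a function F, which may be small somewhere.
   With e_d the signed elementary symmetric functions, one gets P_d(W) F close to W^M e_d, where M
   clears the negative powers of the operator. As e_0 = 1 and W has modulus 1, F cancels when the
   polynomial with coefficients P_d(W) is compared with its leading coefficient: w is an asymptotic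
   root of it, and no limit of the coefficients is taken. *)
From HB Require Import structures.
Require Import Defs.
From mathcomp Require Import all_boot all_order all_algebra.
From mathcomp Require Import sesquilinear perm complex ring lra.
From mathcomp Require Import all_classical all_reals all_analysis.
From mathcomp Require Import measurable_realfun zify.

Set Implicit Arguments.
Unset Strict Implicit.
Unset Printing Implicit Defensive.
Import Order.TTheory GRing.Theory Num.Theory.
Import numFieldTopology.Exports numFieldNormedType.Exports.

Local Open Scope classical_set_scope.
Local Open Scope ring_scope.

(** * Complex integrals on product spaces *)

Section ProductMeasures.
Variable R : realType.

Section finite_product.
Context d1 d2 (X : measurableType d1) (Y : measurableType d2).
Variables (P : {finite_measure set X -> \bar R}) (Q : {finite_measure set Y -> \bar R}).

Let fin : fin_num_fun (P \x Q)%E.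
Proof.
move=> A mA; rewrite ge0_fin_numE; last exact: measure_ge0.
apply: (@le_lt_trans _ _ ((P \x Q)%E setT)).
  by apply: le_measure; rewrite ?inE.
rewrite -setXTT product_measure1E//.
by rewrite -ge0_fin_numE ?mule_ge0// fin_numM ?fin_num_measure.
Qed.

Definition prodm : set (X * Y) -> \bar R := (P \x Q)%E.
HB.instance Definition _ := Measure.on prodm.
HB.instance Definition _ := Measure_isFinite.Build _ _ _ prodm fin.

Lemma prodmE (A : set X) (B : set Y) : measurable A -> measurable B ->
  prodm (A `*` B) = (P A * Q B)%E.
Proof. exact: product_measure1E. Qed.

Lemma integrable_prodm (f : X -> R) (g : Y -> R) :
  P.-integrable setT (EFin \o f) -> Q.-integrable setT (EFin \o g) ->
  prodm.-integrable setT (EFin \o (fun z => f z.1 * g z.2)).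
Proof.
move=> fi gi.
have mf := measurable_int _ fi; have mg := measurable_int _ gi.
have mf' : measurable_fun setT f by exact/measurable_EFinP.
have mg' : measurable_fun setT g by exact/measurable_EFinP.
have m : measurable_fun setT (EFin \o (fun z : X * Y => f z.1 * g z.2)).
  apply/measurable_EFinP/measurable_funM; exact: measurableT_comp.
apply/(@integrable12ltyP _ _ _ _ _ P Q) => //.
have /integrableP[_ fo] := fi; have /integrableP[_ go] := gi.
rewrite (eq_integral (fun x => (`|(f x)%:E| * \int[Q]_y `|(g y)%:E|)%E)).
  rewrite ge0_integralZr//.
  - by apply: lte_mul_pinfty => //; rewrite ?integral_ge0// ge0_fin_numE ?integral_ge0.
  - exact: measurableT_comp.
  - by rewrite integral_ge0.
move=> x _; rewrite -ge0_integralZl//; last exact: measurableT_comp.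
by apply: eq_integral => y _; rewrite /= normrM EFinM.
Qed.

Lemma Rintegral_prodm (f : X -> R) (g : Y -> R) :
  P.-integrable setT (EFin \o f) -> Q.-integrable setT (EFin \o g) ->
  \int[prodm]_z (f z.1 * g z.2) = (\int[P]_x f x) * (\int[Q]_y g y).
Proof.
move=> fi gi; rewrite /Rintegral.
rewrite -[X in fine X](@integral12_prod_meas1 _ _ _ _ _ P Q); last exact: integrable_prodm.
transitivity (fine (\int[P]_x ((f x)%:E * (\int[Q]_y g y)%:E)%E)).
  congr fine; apply: eq_integral => x _; rewrite /fubini_F /=.
  rewrite (eq_integral (fun y => ((f x)%:E * (g y)%:E)%E)) => [|y _]; last by rewrite EFinM.
  by rewrite integralZl// /Rintegral fineK// integrable_fin_num.
rewrite integralZr// fineM//.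
exact: (integrable_fin_num measurableT fi).
Qed.

End finite_product.
End ProductMeasures.

Section ComplexIntegrals.
Variable R : realType.
Local Notation C := R[i].

Section measurability.
Context d (X : measurableType d).

Definition cmeas (f : X -> C) :=
  measurable_fun setT (fun x => complex.Re (f x)) /\
  measurable_fun setT (fun x => complex.Im (f x)).

Lemma cmeas_cst (a : C) : cmeas (fun=> a).
Proof. by split; exact: measurable_cst. Qed.

Lemma cmeasD f g : cmeas f -> cmeas g -> cmeas (fun x => f x + g x).
Proof.
move=> [f1 f2] [g1 g2]; split.
  rewrite (_ : (fun x => _) = (fun x => complex.Re (f x) + complex.Re (g x))).
    exact: measurable_funD.
  by apply/funext => x; case: (f x) (g x) => ? ? [].
rewrite (_ : (fun x => _) = (fun x => complex.Im (f x) + complex.Im (g x))).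
  exact: measurable_funD.
by apply/funext => x; case: (f x) (g x) => ? ? [].
Qed.

Lemma cmeasM f g : cmeas f -> cmeas g -> cmeas (fun x => f x * g x).
Proof.
move=> [f1 f2] [g1 g2]; split.
  rewrite (_ : (fun x => _) = (fun x => complex.Re (f x) * complex.Re (g x) -
      complex.Im (f x) * complex.Im (g x))).
    by apply: measurable_funB; exact: measurable_funM.
  by apply/funext => x; case: (f x) (g x) => ? ? [].
rewrite (_ : (fun x => _) = (fun x => complex.Re (f x) * complex.Im (g x) +
    complex.Im (f x) * complex.Re (g x))).
  by apply: measurable_funD; exact: measurable_funM.
by apply/funext => x; case: (f x) (g x) => ? ? [].
Qed.

Lemma cmeas_sum (I : Type) (s : seq I) (f : I -> X -> C) :
  (forall i, cmeas (f i)) -> cmeas (fun x => \sum_(i <- s) f i x).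
Proof.
move=> mf; elim: s => [|i s IH].
  by under eq_fun do rewrite big_nil; exact: cmeas_cst.
by under eq_fun do rewrite big_cons; exact: cmeasD.
Qed.

Lemma cmeasX f n : cmeas f -> cmeas (fun x => f x ^+ n).
Proof.
move=> mf; elim: n => [|n IH]; first exact: cmeas_cst.
by under eq_fun do rewrite exprS; exact: cmeasM.
Qed.

End measurability.

Lemma cmeas_comp d d' (X : measurableType d) (Y : measurableType d') (h : X -> Y)
    (f : Y -> C) : measurable_fun setT h -> cmeas f -> cmeas (fun x => f (h x)).
Proof.
by move=> mh [f1 f2]; split; [exact: (measurableT_comp f1 mh)|exact: (measurableT_comp f2 mh)].
Qed.

(** Real-valued, unlike the norm of [C], so that it can be integrated and compared with real
    bounds. *)
Definition sqmod (z : C) : R := complex.Re z ^+ 2 + complex.Im z ^+ 2.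

Section integrability.
Context d (X : measurableType d).
Variable mu : {measure set X -> \bar R}.

Definition Cint (f : X -> C) :=
  mu.-integrable setT (EFin \o (fun x => complex.Re (f x))) /\
  mu.-integrable setT (EFin \o (fun x => complex.Im (f x))).

Let iZ (c : R) (h : X -> R) : mu.-integrable setT (EFin \o h) ->
    mu.-integrable setT (EFin \o (fun x => c * h x)).
Proof.
by move=> ih; apply: (@eq_integrable _ _ _ mu _ measurableT _ _ _ (integrableZl measurableT c ih)).
Qed.
Let iB (h k : X -> R) : mu.-integrable setT (EFin \o h) ->
    mu.-integrable setT (EFin \o k) ->
    mu.-integrable setT (EFin \o (fun x => h x - k x)).
Proof.
by move=> ih ik; apply: (@eq_integrable _ _ _ mu _ measurableT _ _ _ (integrableB measurableT ih
    ik)).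
Qed.
Let iD (h k : X -> R) : mu.-integrable setT (EFin \o h) ->
    mu.-integrable setT (EFin \o k) ->
    mu.-integrable setT (EFin \o (fun x => h x + k x)).
Proof.
by move=> ih ik; apply: (@eq_integrable _ _ _ mu _ measurableT _ _ _ (integrableD measurableT ih
    ik)).
Qed.

Lemma CintD f g : Cint f -> Cint g -> Cint (fun x => f x + g x).
Proof.
move=> [f1 f2] [g1 g2]; split.
  rewrite (_ : (fun x => _) = (fun x => complex.Re (f x) + complex.Re (g x))).
    exact: iD.
  by apply/funext => x; case: (f x) (g x) => ? ? [].
rewrite (_ : (fun x => _) = (fun x => complex.Im (f x) + complex.Im (g x))).
  exact: iD.
by apply/funext => x; case: (f x) (g x) => ? ? [].
Qed.

Lemma CintZ a f : Cint f -> Cint (fun x => a * f x).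
Proof.
move=> [f1 f2]; split.
  rewrite (_ : (fun x => _) =
      (fun x => complex.Re a * complex.Re (f x) - complex.Im a * complex.Im (f x))).
    by apply: iB; exact: iZ.
  by apply/funext => x; case: a (f x) => ? ? [].
rewrite (_ : (fun x => _) =
    (fun x => complex.Re a * complex.Im (f x) + complex.Im a * complex.Re (f x))).
  by apply: iD; exact: iZ.
by apply/funext => x; case: a (f x) => ? ? [].
Qed.

Lemma Cint0 : Cint (fun=> 0).
Proof. by split; exact: integrable0. Qed.

Lemma CintegralD f g : Cint f -> Cint g ->
  Cintegral mu (fun x => f x + g x) = Cintegral mu f + Cintegral mu g.
Proof.
move=> [f1 f2] [g1 g2]; rewrite /Cintegral -[RHS]/(Complex (_ + _) (_ + _)).
rewrite -!RintegralD//.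
by congr Complex; apply: eq_Rintegral => x _; case: (f x) (g x) => ? ? [].
Qed.

Lemma CintegralZ a f : Cint f -> Cintegral mu (fun x => a * f x) = a * Cintegral mu f.
Proof.
move=> [f1 f2]; case: a => a b; rewrite /Cintegral.
rewrite -[RHS]/(Complex (a * _ - b * _) (a * _ + b * _)).
rewrite -!RintegralZl// -RintegralB ?iZ// -RintegralD ?iZ//.
by congr Complex; apply: eq_Rintegral => x _; case: (f x).
Qed.

Lemma Cintegral0 : Cintegral mu (fun=> 0) = 0.
Proof. by rewrite /Cintegral/= /Rintegral integral0. Qed.

Lemma Cint_sum (I : Type) (s : seq I) (f : I -> X -> C) :
  (forall i, Cint (f i)) -> Cint (fun x => \sum_(i <- s) f i x) /\
  Cintegral mu (fun x => \sum_(i <- s) f i x) = \sum_(i <- s) Cintegral mu (f i).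
Proof.
move=> mf; elim: s => [|i s [IH1 IH2]].
  rewrite big_nil (_ : (fun x => _) = fun=> 0); last by apply/funext => x; rewrite big_nil.
  by split; [exact: Cint0|exact: Cintegral0].
rewrite big_cons (_ : (fun x => _) = fun x => f i x + \sum_(j <- s) f j x).
  by split; [exact: CintD|rewrite CintegralD// IH2].
by apply/funext => x; rewrite big_cons.
Qed.

Lemma Cint_mul_L2fun (f g : L2fun mu) : Cint (fun x => f x * (g x)^*).
Proof.
have /andP[f1 f2] := valP f; have /andP[g1 g2] := valP g.
have M (h k : X -> R) : h \in Lfun mu 2%:E -> k \in Lfun mu 2%:E ->
    mu.-integrable setT (EFin \o (h \* k)).
  by move=> hL kL; apply/Lfun1_integrable; exact: Lfun2_mul_Lfun1.
split.
  rewrite (_ : (fun x => _) = (fun x => complex.Re (f x) * complex.Re (g x) +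
      complex.Im (f x) * complex.Im (g x))).
    by apply: iD; exact: M.
  by apply/funext => x; case: (f x) (g x) => ? ? [? ?] /=; rewrite mulrN opprK.
rewrite (_ : (fun x => _) = (fun x => complex.Im (f x) * complex.Re (g x) -
    complex.Re (f x) * complex.Im (g x))).
  by apply: iB; exact: M.
by apply/funext => x; case: (f x) (g x) => ? ? [? ?] /=; rewrite mulrN addrC.
Qed.

End integrability.

Lemma Cint_indic d (X : measurableType d) (mu : {finite_measure set X -> \bar R})
    (A : set X) : measurable A ->
  Cint mu (fun x => (\1_A x)%:C%C) /\
  Cintegral mu (fun x => (\1_A x)%:C%C) = (fine (mu A))%:C%C.
Proof.
move=> mA; split; last first.
  congr Complex; first by rewrite /Rintegral /= integral_indic ?setIT.
  by rewrite /Rintegral /= integral0.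
split => /=; last exact: integrable0.
exact: integrable_indic.
Qed.

Section prodm.
Context d1 d2 (X : measurableType d1) (Y : measurableType d2).
Variables (P : {finite_measure set X -> \bar R}) (Q : {finite_measure set Y -> \bar R}).

Lemma Cint_prodm (f : X -> C) (g : Y -> C) : Cint P f -> Cint Q g ->
  Cint (prodm P Q) (fun z => f z.1 * g z.2) /\
  Cintegral (prodm P Q) (fun z => f z.1 * g z.2) = Cintegral P f * Cintegral Q g.
Proof.
move=> [f1 f2] [g1 g2].
have R1 : (fun z => complex.Re (f z.1 * g z.2)) = (fun z => complex.Re (f z.1) * complex.Re (g
    z.2) -
    complex.Im (f z.1) * complex.Im (g z.2)).
  by apply/funext => -[x y] /=; case: (f x) (g y) => ? ? [].
have R2 : (fun z => complex.Im (f z.1 * g z.2)) = (fun z => complex.Re (f z.1) * complex.Im (g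
    z.2) +
    complex.Im (f z.1) * complex.Re (g z.2)).
  by apply/funext => -[x y] /=; case: (f x) (g y) => ? ? [].
have H := integrable_prodm.
rewrite /Cint /Cintegral R1 R2; split.
  split.
    exact: (@eq_integrable _ _ _ (prodm P Q) _ measurableT _ _ _
      (integrableB measurableT (H _ _ _ _ _ P Q _ _ f1 g1) (H _ _ _ _ _ P Q _ _ f2 g2))).
  exact: (@eq_integrable _ _ _ (prodm P Q) _ measurableT _ _ _
      (integrableD measurableT (H _ _ _ _ _ P Q _ _ f1 g2) (H _ _ _ _ _ P Q _ _ f2 g1))).
have E h k (hi : P.-integrable setT (EFin \o h)) (ki : Q.-integrable setT (EFin \o k)) :=
  Rintegral_prodm hi ki.
rewrite RintegralB//; [|exact: H f1 g1|exact: H f2 g2].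
rewrite RintegralD//; [|exact: H f1 g2|exact: H f2 g1].
by rewrite (E _ _ f1 g1) (E _ _ f1 g2) (E _ _ f2 g1) (E _ _ f2 g2).
Qed.

End prodm.
End ComplexIntegrals.

(** * Null sets of product measures and independence *)

Section ProductNull.
Variable R : realType.

Lemma measurable_forall d (X : measurableType d) (J : countType) (F : J -> set X) :
  (forall i, measurable (F i)) -> measurable [set w | forall i, F i w].
Proof.
move=> mF; rewrite (_ : [set w | _] = ~` (\bigcup_i ~` F i)).
  apply/measurableC/countable_bigcupT_measurable; first exact: countableP.
  by move=> i; exact: measurableC.
rewrite setC_bigcup; apply/seteqP; split => w /= h i; first by move=> _; rewrite setCK.
by have := h i I; rewrite setCK.
Qed.

Section push.
Context d1 d2 (X : measurableType d1) (Y : measurableType d2).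
Variables (P : {finite_measure set X -> \bar R}) (f : X -> Y).
Hypothesis mf : measurable_fun setT f.

(** The proof of measurability is an argument so that the measure instances can be attached to the
    term [pushm mf]. *)
Definition pushm of measurable_fun setT f : set Y -> \bar R := pushforward P f.

Let pushm0 : pushm mf set0 = 0%E.
Proof. by rewrite /pushm /pushforward preimage_set0 measure0. Qed.

Let pushm_ge0 A : (0 <= pushm mf A)%E.
Proof. by rewrite /pushm /pushforward; exact: measure_ge0. Qed.

Let pushm_sigma_additive : semi_sigma_additive (pushm mf).
Proof. exact: measure_semi_sigma_additive. Qed.

HB.instance Definition _ := isMeasure.Build _ _ _ (pushm mf)
  pushm0 pushm_ge0 pushm_sigma_additive.

Let pushm_fin : fin_num_fun (pushm mf).
Proof.
move=> A mA; rewrite /pushm /pushforward fin_num_measure//.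
by rewrite -[X in measurable X]setTI; exact: mf.
Qed.

HB.instance Definition _ := Measure_isFinite.Build _ _ _ (pushm mf) pushm_fin.

End push.

Lemma measurable_preimageT d1 d2 (X : measurableType d1) (Y : measurableType d2)
    (f : X -> Y) (A : set Y) : measurable_fun setT f -> measurable A -> measurable (f @^-1` A).
Proof. by move=> mf mA; rewrite -[X in measurable X]setTI; exact: mf. Qed.

Section prodm_null.
Context d1 d2 (X : measurableType d1) (Y : measurableType d2).
Implicit Types (P : {finite_measure set X -> \bar R}) (Q : {finite_measure set Y -> \bar R}).

Lemma measurable_section_neq0 Q (E : set (X * Y)) : measurable E ->
  measurable [set x | Q (xsection E x) != 0%E].
Proof.
move=> mE; have m := measurable_fun_xsection Q mE.
rewrite (_ : [set x | _] = ~` ((Q \o xsection E) @^-1` [set 0%E])).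
  exact/measurableC/measurable_preimageT.
by apply/seteqP; split => x /= /eqP.
Qed.

Lemma prodm_eq0 P Q (E : set (X * Y)) : measurable E ->
  prodm P Q E = 0%E <-> P [set x | Q (xsection E x) != 0%E] = 0%E.
Proof.
move=> mE; have m := measurable_fun_xsection Q mE.
have -> : prodm P Q E = (\int[P]_x `|(Q \o xsection E) x|)%E.
  by apply: eq_integral => x _ /=; rewrite gee0_abs.
split.
  move=> /(ae_eq_integral_abs _ measurableT m) [N [mN N0 sN]].
  apply: (subset_measure0 _ mN _ N0); first exact: measurable_section_neq0.
  move=> x /= /eqP xE; apply: sN => /= /(_ I); exact: xE.
move=> P0; apply/(ae_eq_integral_abs _ measurableT m).
exists [set x | Q (xsection E x) != 0%E]; split => //.
  exact: measurable_section_neq0.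
by move=> x /= h; apply/eqP => h0; apply: h.
Qed.

End prodm_null.

Lemma prodm_law d1 d2 d1' d2' (X : measurableType d1) (Y : measurableType d2)
    (X' : measurableType d1') (Y' : measurableType d2')
    (P : {finite_measure set X -> \bar R}) (Q : {finite_measure set Y -> \bar R})
    (P' : {finite_measure set X' -> \bar R}) (Q' : {finite_measure set Y' -> \bar R})
    (f : X -> X') (g : Y -> Y') :
  measurable_fun setT f -> measurable_fun setT g ->
  (forall A, measurable A -> P (f @^-1` A) = P' A) ->
  (forall B, measurable B -> Q (g @^-1` B) = Q' B) ->
  forall E, measurable E ->
    prodm P Q [set z | E (f z.1, g z.2)] = prodm P' Q' E.
Proof.
move=> mf mg PP QQ E mE.
have mh : measurable_fun setT (fun z : X * Y => (f z.1, g z.2)).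
  by apply: measurable_fun_pair; exact: measurableT_comp.
apply/esym; apply: (@product_measure_unique _ _ _ _ _ P' Q' (pushm (prodm P Q) mh)) => //.
move=> A B mA mB; transitivity (prodm P Q ((f @^-1` A) `*` (g @^-1` B))).
  by rewrite /= /pushm /pushforward; congr (prodm P Q _); apply/seteqP; split => -[x y].
by rewrite prodmE ?PP ?QQ//; exact: measurable_preimageT.
Qed.

End ProductNull.

Section Indep.
Variable R : realType.
Local Notation C := R[i].
Local Notation T := (circle R).
Local Notation finmeas := {finite_measure set T -> \bar R}.

Definition boxes (I : finType) : set (set (I -> T)) :=
  [set B | exists A : I -> set T, (forall i, measurable (A i)) /\
     B = [set x | forall i, A i (x i)]].

(** The product sigma-algebra, presented through a pi-system on which laws can be compared. *)
Definition fspace (I : finType) : measurableType _ := g_sigma_algebraType (@boxes I).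

Lemma measurable_coord (I : finType) (i : I) :
  measurable_fun setT (fun x : fspace I => x i).
Proof.
move=> _ A mA; rewrite setTI; apply: sub_sigma_algebra.
exists (fun j => if j == i then A else setT); split.
  by move=> j; case: ifP.
apply/seteqP; split => x /=; first by move=> xi j; case: eqP => [->|].
by move=> /(_ i); rewrite eqxx.
Qed.

Lemma measurable_joint (I : finType) d (X : measurableType d) (c : I -> X -> T) :
  (forall i, measurable_fun setT (c i)) ->
  measurable_fun setT (fun w => (fun i => c i w) : fspace I).
Proof.
move=> mc; apply: (measurability _ (erefl : @measurable _ (fspace I) = <<s @boxes I >>)).
move=> _ [_ [A [mA ->]] <-]; rewrite setTI.
by apply: (measurable_forall (F := fun i => c i @^-1` A i)) => i; exact: measurable_preimageT.
Qed.

Section def.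
Context d (X : measurableType d) (P : {finite_measure set X -> \bar R}).
Variables (I : finType) (nu : I -> finmeas) (c : I -> X -> T).

(* The family c is independent under P, with joint law the product of the nu i: the
   complex moments of product form determine this law. No measure is normalized. *)
Definition indep := (forall i, measurable_fun setT (c i)) /\
  forall g : I -> T -> C, (forall i, Cint (nu i) (g i)) ->
    Cint P (fun w => \prod_i g i (c i w)) /\
    Cintegral P (fun w => \prod_i g i (c i w)) = \prod_i Cintegral (nu i) (g i).

(** Take indicators for the [g i]: their product is the indicator of the box. *)
Lemma indep_box (A : I -> set T) : indep -> (forall i, measurable (A i)) ->
  P [set w | forall i, A i (c i w)] = (\prod_i fine (nu i (A i)))%:E.
Proof.
move=> [mc h] mA.
have mB : measurable [set w | forall i, A i (c i w)].
  by apply: (measurable_forall (F := fun i => c i @^-1` A i)) => i; exact: measurable_preimageT.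
have [] := h (fun i x => (\1_(A i) x)%:C%C); first by move=> i; exact: (Cint_indic (nu i) (mA i)).1.
under [X in _ -> _ = X -> _]eq_bigr do rewrite (Cint_indic _ (mA _)).2.
rewrite (_ : (fun w => _) = (fun w => (\1_[set w | forall i, A i (c i w)] w)%:C%C)).
  move=> _; rewrite (Cint_indic P mB).2 -rmorph_prod/= => -[] <-.
  by rewrite fineK// fin_num_measure.
apply/funext => w; rewrite -rmorph_prod/=; congr (_%:C)%C.
rewrite !indicE; case: (boolP (w \in _)) => [|]; rewrite ?inE ?notin_setE/= => H.
  by rewrite big1// => i _; rewrite indicE mem_set.
have [i iA] : exists i, ~ A i (c i w) by apply/existsNP.
by rewrite (bigD1 i)//= indicE memNset// mul0r.
Qed.

End def.

(** Boxes form a generating pi-system that contains the whole space, so they determine a finite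
    measure. Hence any convenient model of an independent family may be used to compute
    probabilities. *)
Lemma indep_unique d d' (X : measurableType d) (Y : measurableType d')
    (P : {finite_measure set X -> \bar R}) (Q : {finite_measure set Y -> \bar R})
    (I : finType) (nu : I -> finmeas) (c : I -> X -> T) (c' : I -> Y -> T) (E : set (fspace I)) :
  indep P nu c -> indep Q nu c' -> measurable E ->
  P [set w | E (fun i => c i w)] = Q [set w | E (fun i => c' i w)].
Proof.
move=> ic ic' mE.
have mc := measurable_joint ic.1; have mc' := measurable_joint ic'.1.
rewrite -[LHS]/(pushm P mc E) -[RHS]/(pushm Q mc' E).
have H := @measure_unique _ _ (fspace I) (@boxes I) (fun=> setT) _ _ _ _ (pushm P mc) (pushm Q mc').
apply: H => //.
- move=> _ _ [A [mA ->]] [B [mB ->]]; exists (fun i => A i `&` B i); split.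
    by move=> i; exact: measurableI.
  by apply/seteqP; split => x /=; [move=> [a b] i; split|move=> h; split => i; case: (h i)].
- by move=> _; exists (fun=> setT); split => //; apply/seteqP.
- by apply: bigcup_const; exists 0%N.
- move=> _ [A [mA ->]].
  exact: (etrans (indep_box ic mA) (esym (indep_box ic' mA))).
- by move=> _; rewrite -ge0_fin_numE// fin_num_measure.
Qed.

Lemma indep_sum d d' (X : measurableType d) (Y : measurableType d')
    (P : {finite_measure set X -> \bar R}) (Q : {finite_measure set Y -> \bar R})
    (I J : finType) (nu : I -> finmeas) (mu : J -> finmeas) c c' :
  indep P nu c -> indep Q mu c' ->
  indep (prodm P Q) (fun i : I + J => match i with inl i => nu i | inr j => mu j end)
    (fun i z => match i with inl i => c i z.1 | inr j => c' j z.2 end).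
Proof.
move=> [mc h] [mc' h']; split.
  by move=> [i|j]; exact: measurableT_comp.
move=> g ig.
have [a1 a2] := h (fun i => g (inl i)) (fun i => ig (inl i)).
have [b1 b2] := h' (fun i => g (inr i)) (fun i => ig (inr i)).
have [c1 c2] := Cint_prodm a1 b1.
rewrite big_sumType/= -a2 -b2 -c2.
by rewrite (_ : (fun w => _) = (fun z => (\prod_i g (inl i) (c i z.1)) *
  \prod_i g (inr i) (c' i z.2)))//; apply/funext => z; rewrite big_sumType.
Qed.

Lemma indep_reindex d (X : measurableType d) (P : {finite_measure set X -> \bar R})
    (I J : finType) (nu : I -> finmeas) c (h : J -> I) : bijective h ->
  indep P nu c -> indep P (fun j => nu (h j)) (fun j => c (h j)).
Proof.
move=> bh [mc H]; split; first by move=> j; exact: mc.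
have [k hk kh] := bh.
move=> g ig; have [|] := H (fun i => g (k i)).
  by move=> i; rewrite -{1}(kh i); exact: ig.
rewrite (reindex h)/=; last by apply: onW_bij.
under eq_bigr do rewrite hk.
rewrite (_ : (fun w => _) = (fun w => \prod_i g i (c (h i) w)))//.
apply/funext => w; rewrite (reindex h)/=; last by apply: onW_bij.
by under eq_bigr do rewrite hk.
Qed.

Lemma indep1 (nu : finmeas) : indep nu (fun _ : unit => nu) (fun _ x => x).
Proof.
split; first by move=> _; exact: measurable_id.
move=> g ig; have u (F : unit -> C) : \prod_i F i = F tt.
  by rewrite (bigD1 tt)//= big1 ?mulr1// => -[].
by rewrite u; under eq_fun do rewrite u; split; [exact: ig|].
Qed.

End Indep.

(** * Products of points and convolutions *)

Section CircleProducts.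
Variable R : realType.
Local Notation C := R[i].
Local Notation T := (circle R).
Local Notation finmeas := {finite_measure set T -> \bar R}.

Lemma circle_mulA : associative (@circle_mul R).
Proof. by move=> x y z; apply/val_inj; rewrite /= mulrA. Qed.

Lemma circle_mulC : commutative (@circle_mul R).
Proof. by move=> x y; apply/val_inj; rewrite /= mulrC. Qed.

Lemma circle_mul1 : left_id (circle1 R) (@circle_mul R).
Proof. by move=> x; apply/val_inj; rewrite /= mul1r. Qed.

HB.instance Definition _ := Monoid.isComLaw.Build T (circle1 R) (@circle_mul R)
  circle_mulA circle_mulC circle_mul1.

Lemma circle_mulI (z : T) : injective (circle_mul z).
Proof.
move=> x y /(congr1 val) /= h; apply/val_inj/(@mulfI _ (z : C)) => //.
by rewrite -normr_eq0 (eqP (circle_valP z)) oner_eq0.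
Qed.

Definition cprod (I : finType) (x : I -> T) : T := \big[@circle_mul R/circle1 R]_i x i.

Lemma cprod_val (I : finType) (x : I -> T) : (cprod x : C) = \prod_i (x i : C).
Proof. by rewrite /cprod; apply: (big_morph (@circle_val R)). Qed.

Lemma measurable_circle_mulT d (X : measurableType d) (f g : X -> T) :
  measurable_fun setT f -> measurable_fun setT g ->
  measurable_fun setT (fun w => circle_mul (f w) (g w)).
Proof.
move=> mf mg; have mp : measurable_fun setT (fun w => (f w, g w)).
  exact: measurable_fun_pair.
exact: (measurableT_comp (@measurable_circle_mul R) mp).
Qed.

Lemma measurable_cprod d (X : measurableType d) (I : finType) (c : I -> X -> T) :
  (forall i, measurable_fun setT (c i)) ->
  measurable_fun setT (fun w => cprod (fun i => c i w)).
Proof.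
move=> mc; rewrite /cprod; elim: (index_enum I) => [|i s IH].
  by under eq_fun do rewrite big_nil; exact: measurable_cst.
by under eq_fun do rewrite big_cons; exact: measurable_circle_mulT.
Qed.

Lemma cprod_sum (I J : finType) (x : I + J -> T) :
  cprod x = circle_mul (cprod (fun i => x (inl i))) (cprod (fun j => x (inr j))).
Proof. exact: big_sumType. Qed.

Lemma cprod_reindex (I J : finType) (h : J -> I) (x : I -> T) :
  bijective h -> cprod (fun j => x (h j)) = cprod x.
Proof. by move=> bh; rewrite [RHS](reindex h)//; exact: onW_bij. Qed.

Definition split0 m (i : 'I_m.+1) : unit + 'I_m :=
  if unlift ord0 i is Some j then inr j else inl tt.

Lemma split0_bij m : bijective (@split0 m).
Proof.
exists (fun u => match u with inl _ => ord0 | inr j => lift ord0 j end).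
  by move=> i; rewrite /split0; case: unliftP => [j|] ->.
by case=> [[]|j]; rewrite /split0 ?unlift_none ?liftK.
Qed.

Lemma conv_seqS m (nu : 'I_m.+1 -> finmeas) A :
  conv_seq nu A = prodm (nu ord0) (conv_seq (fun i => nu (lift ord0 i)))
    [set z | A (circle_mul z.1 z.2)].
Proof. by rewrite /conv_seq big_ord_recl. Qed.

Lemma indep_ord m (nu : 'I_m -> finmeas) :
  exists (d : measure_display) (X : measurableType d)
    (P : {finite_measure set X -> \bar R}) (c : 'I_m -> X -> T),
    indep P nu c /\ forall A, measurable A ->
      P [set w | A (cprod (fun i => c i w))] = conv_seq nu A.
Proof.
elim: m => [|m IH] in nu *.
  (* The empty family needs total mass 1, the empty product; the Dirac mass at 1 is also the empty
     convolution. *)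
  exists _, T, (dirac (circle1 R) : finmeas), (fun _ _ => circle1 R); split.
    split; first by case.
    move=> g _.
    have [] := Cint_indic (dirac (circle1 R) : finmeas) (@measurableT _ T).
    rewrite (_ : (fun x => _) = fun=> 1%:C%C); last first.
      by apply/funext => x; rewrite indicE in_setT.
    rewrite (_ : (fun w => _) = fun=> 1%:C%C).
      move=> h1 h2; split; first exact: h1.
      by rewrite h2 big_ord0 /= /dirac indicE in_setT.
    by apply/funext => x; rewrite big_ord0.
  move=> A mA; rewrite /conv_seq /cprod big_ord0.
  rewrite (_ : [set w | _] = if circle1 R \in A then setT else set0).
    by rewrite /= /dirac !indicE; case: ifPn => h; rewrite ?in_setT ?in_set0.
  apply/seteqP; split => w /=; rewrite big_ord0; first by move=> h; rewrite mem_set.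
  by case: ifPn => // /set_mem.
have [d [X [P [c [ic lc]]]]] := IH (fun i => nu (lift ord0 i)).
have := indep_reindex (@split0_bij m) (indep_sum (indep1 (nu ord0)) ic).
set c' := (fun _ => _ : T * X -> T); set nu' := fun _ => _ => h.
have nu'E : nu' = nu.
  by apply/funext => i; rewrite /nu' /split0; case: unliftP => [j|] ->.
rewrite nu'E in h.
exists _, (T * X)%type, (prodm (nu ord0) P), c'; split => // A mA.
have mg := measurable_cprod ic.1.
have E z : cprod (fun i => c' i z) = circle_mul z.1 (cprod (fun i => c i z.2)).
  rewrite -[LHS]/(cprod (fun i => (fun u => match u with inl _ => z.1 | inr j => c j z.2 end)
    (split0 i))) cprod_reindex; last exact: split0_bij.
  rewrite cprod_sum /=; congr circle_mul.
  rewrite /cprod (bigD1 tt)//= big1 => [|[]//].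
  by rewrite circle_mulC circle_mul1.
rewrite conv_seqS -(prodm_law (P := nu ord0) (f := id) (@measurable_id _ _ _) mg (fun _ _ =>
    erefl) lc).
  by congr (prodm _ _ _); apply/seteqP; split => z /=; rewrite E.
apply: (measurable_preimageT (f := fun z : T * T => circle_mul z.1 z.2)) => //.
exact: measurable_circle_mul.
Qed.

Lemma indep_law m (nu : 'I_m -> finmeas) d (X : measurableType d)
    (P : {finite_measure set X -> \bar R}) (c : 'I_m -> X -> T) A :
  indep P nu c -> measurable A ->
  P [set w | A (cprod (fun i => c i w))] = conv_seq nu A.
Proof.
move=> ic mA; have [d' [Y [Q [c' [ic' lc']]]]] := indep_ord nu.
rewrite -lc'//; apply: (indep_unique (E := [set x | A (cprod x)]) ic ic').
apply: (measurable_preimageT (f := fun x : fspace R 'I_m => cprod x)) => //.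
by apply: (measurable_cprod (X := fspace R 'I_m) (c := fun i x => x i)) => i; exact:
    measurable_coord.
Qed.

Lemma indep_exists (I : finType) (nu : I -> finmeas) :
  exists (d : measure_display) (X : measurableType d)
    (P : {finite_measure set X -> \bar R}) (c : I -> X -> T), indep P nu c.
Proof.
have [d [X [P [c [ic _]]]]] := indep_ord (fun j : 'I_#|I| => nu (enum_val j)).
exists d, X, P, (fun i => c (enum_rank i)).
have := indep_reindex (@enum_rank_bij I) ic.
by rewrite (_ : (fun j => nu _) = nu)//; apply/funext => i; rewrite enum_rankK.
Qed.

End CircleProducts.

(** * Elements of the tensor power as functions on a power of the circle *)

(** The sum of the [g j] has integral at most 1, hence is almost everywhere finite, and the tails of
    a convergent series dominate its terms. *)
Lemma summable_integrals_cvg0 (R : realType) d (X : measurableType d)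
    (P : {measure set X -> \bar R}) (g : nat -> X -> R) :
  (forall j, measurable_fun setT (g j)) -> (forall j w, 0 <= g j w) ->
  (forall j, (\int[P]_w (g j w)%:E <= (1 / (2 ^ j.+1)%:R)%:E)%E) ->
  {ae P, forall w, forall e, 0 < e -> exists m, forall j, (m <= j)%N -> g j w < e}.
Proof.
move=> mg g0 ig; pose G w := (\sum_(j <oo) (g j w)%:E)%E.
have mG : measurable_fun setT G.
  apply: ge0_emeasurable_sum => //; first by move=> j w _ _; rewrite lee_fin.
  by move=> j _; apply/measurable_EFinP.
have G0 w : (0 <= G w)%E by apply: nneseries_ge0 => n _ _; rewrite lee_fin.
have iG : P.-integrable setT G.
  apply/integrableP; split => //.
  under eq_integral => w _ do rewrite gee0_abs//.
  rewrite integral_nneseries//; last first.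
    by move=> n w _; rewrite lee_fin.
    by move=> n; apply/measurable_EFinP.
  apply: le_lt_trans (ltry 1); apply: le_trans (epsilon_trick0 xpredT _) => //.
  by apply: lee_nneseries => // i _ _; apply: integral_ge0 => w _; rewrite lee_fin.
apply: filterS (integrable_ae measurableT iG) => w /(_ I).
rewrite ge0_fin_numE// => Goo e e0.
have := nneseries_tail_cvg Goo (fun j _ => g0 j w).
move=> /fine_cvgP[_] /cvgrPdist_lt /(_ e e0)[m _ H]; exists m => j mj.
have := H j mj.
have t0 : (0 <= \sum_(j <= k <oo) (g k w)%:E)%E.
  by apply: nneseries_ge0 => n _ _; rewrite lee_fin.
have tl : ((g j w)%:E <= \sum_(j <= k <oo) (g k w)%:E)%E.
  rewrite (nneseries_split _ 1)//; last by move=> k _; rewrite lee_fin.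
  rewrite addn1 big_nat1 leeDl//.
  by apply: nneseries_ge0 => n _ _; rewrite lee_fin.
rewrite sub0r normrN ger0_norm ?fine_ge0//; apply: le_lt_trans.
rewrite -lee_fin fineK// ge0_fin_numE//; apply: le_lt_trans Goo.
rewrite [leRHS](nneseries_split _ j)//; last by move=> k _; rewrite lee_fin.
by rewrite add0n leeDr// sume_ge0// => k _; rewrite lee_fin.
Qed.

Section Rep.
Variable R : realType.
Local Notation C := R[i].
Local Notation T := (circle R).
Variable sigma : {finite_measure set T -> \bar R}.
Variables (N : nat) (K : tensorPower (L2ips sigma) N).

Let vec (s : seq (C * ('I_N -> L2fun sigma))) : K :=
  \sum_(p <- s) p.1 *: tens K (fun i => L2class (p.2 i)).
Let fn (s : seq (C * ('I_N -> L2fun sigma))) (x : 'I_N -> T) : C :=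
  \sum_(p <- s) p.1 * \prod_i (p.2 i (x i)).

(* [u] corresponds to [F] under the isometry of [K] with L^2(sigma^N). Only finite sums of
   elementary tensors are represented, by functions defined everywhere. *)
Definition represents (u : K) (F : ('I_N -> T) -> C) :=
  exists s, u = vec s /\ forall x, F x = fn s x.

Lemma represents_ext u F G : (forall x, F x = G x) -> represents u F -> represents u G.
Proof. by move=> FG [s [-> Fs]]; exists s; split => // x; rewrite -FG. Qed.

Lemma represents_tens (f : 'I_N -> L2fun sigma) :
  represents (tens K (fun i => L2class (f i))) (fun x => \prod_i f i (x i)).
Proof.
by exists [:: (1, f)]; rewrite /vec /fn big_seq1 scale1r; split => // x; rewrite big_seq1 mul1r.
Qed.

Lemma represents_lin a u v F G : represents u F -> represents v G ->
  represents (a *: u + v) (fun x => a * F x + G x).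
Proof.
move=> [s [-> Fs]] [t [-> Gt]]; exists ([seq (a * p.1, p.2) | p <- s] ++ t); split.
  rewrite /vec big_cat big_map/=; congr (_ + _).
  by rewrite scaler_sumr; apply: eq_bigr => p _; rewrite scalerA.
move=> x; rewrite Fs Gt /fn big_cat big_map/=; congr (_ + _).
by rewrite mulr_sumr; apply: eq_bigr => p _; rewrite mulrA.
Qed.

Lemma represents0 : represents 0 (fun=> 0).
Proof. by exists [::]; rewrite /vec /fn big_nil; split => // x; rewrite big_nil. Qed.

Lemma represents_sum (I : Type) (r : seq I) (a : I -> C) (u : I -> K) F :
  (forall i, represents (u i) (F i)) ->
  represents (\sum_(i <- r) a i *: u i) (fun x => \sum_(i <- r) a i * F i x).
Proof.
move=> uF; elim: r => [|i r IH].
  rewrite big_nil; apply: represents_ext represents0 => x; by rewrite big_nil.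
rewrite big_cons; apply: represents_ext (represents_lin (a i) (uF i) IH) => x.
by rewrite big_cons.
Qed.

Lemma represents_dense v e : 0 < e -> exists u F, represents u F /\ ips_norm (v - u) < e.
Proof.
move=> e0; have : closed_span (range (tens K)) v by rewrite tens_total.
move=> /(_ _ e0)[m [c [a [aP ve]]]].
exists (\sum_(j < m) c j *: a j).
have /choice[F FP] : forall j, exists F, represents (a j) F.
  move=> j; have [x _ <-] := aP j; exists (fun z => \prod_i (repr (x i) : L2fun sigma) (z i)).
  have := represents_tens (fun i => repr (x i)).
  by rewrite (_ : (fun i => _) = x)//; apply/funext => i; rewrite L2class_repr.
by exists (fun x => \sum_(j < m) c j * F j x); split => //; exact: represents_sum.
Qed.

Section norm.
Context d (X : measurableType d) (P : {finite_measure set X -> \bar R}).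
Variable c : 'I_N -> X -> T.
Hypothesis ic : indep P (fun=> sigma) c.

(** For elementary tensors both sides are products of one-variable inner products, by [tens_dotp]
    and by independence; the rest is sesquilinearity. Any model of N independent points thus
    computes the geometry of [K]. *)
Lemma represents_inner u v F G : represents u F -> represents v G ->
  Cint P (fun w => F (fun i => c i w) * (G (fun i => c i w))^*) /\
  Cintegral P (fun w => F (fun i => c i w) * (G (fun i => c i w))^*) = dotp K u v.
Proof.
move=> [s [-> Fs]] [t [-> Gt]].
pose h (p q : C * ('I_N -> L2fun sigma)) w : C :=
  \prod_i (p.2 i (c i w) * (q.2 i (c i w))^*).
have hP p q : Cint P (h p q) /\ Cintegral P (h p q) = \prod_i L2inner (L2class (p.2 i)) (L2class
    (q.2 i)).
  have [|h1 h2] := ic.2 (fun i z => p.2 i z * (q.2 i z)^*).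
    by move=> i; exact: Cint_mul_L2fun.
  by split => //; rewrite h2; apply: eq_bigr => i _; rewrite L2inner_class.
have hZ p q : Cint P (fun w => p.1 * q.1^* * h p q w).
  by apply: CintZ; exact: (hP p q).1.
have hs p := Cint_sum t (hZ p).
have [S1 S2] := Cint_sum s (fun p => (hs p).1).
rewrite (_ : (fun w => _) = (fun w => \sum_(p <- s) \sum_(q <- t) p.1 * q.1^* * h p q w)).
  split => //; rewrite S2 /vec linear_sumlz; apply: eq_bigr => p _.
  rewrite (hs p).2 linear_sumr; apply: eq_bigr => q _.
  rewrite CintegralZ; last exact: (hP p q).1.
  by rewrite (hP p q).2 [in RHS]linearZr_LR [in RHS]linearZl_LR/= tens_dotp -mulrA mulrCA.
apply/funext => w; rewrite Fs Gt /fn rmorph_sum mulr_suml; apply: eq_bigr => p _.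
rewrite mulr_sumr; apply: eq_bigr => q _.
by rewrite /h big_split/= rmorphM rmorph_prod/= mulrACA.
Qed.

Lemma represents_norm u F : represents u F ->
  measurable_fun setT (fun w => sqmod (F (fun i => c i w))) /\
  (\int[P]_w (sqmod (F (fun i => c i w)))%:E = (ips_norm u ^+ 2)%:E)%E.
Proof.
move=> uF; have [iF eF] := represents_inner uF uF.
have sE (z : C) : complex.Re (z * z^*) = sqmod z.
  by case: z => a b; rewrite /sqmod /= mulrN opprK.
move: iF eF => [i1 _] /(congr1 (@complex.Re R)) /=.
rewrite -ips_norm_sqr /Rintegral.
have E : (EFin \o (fun w => complex.Re (F (fun i => c i w) * (F (fun i => c i w))^*))) =
    (fun w => (sqmod (F (fun i => c i w)))%:E).
  by apply/funext => w; rewrite /= sE.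
move=> <-; split; first by apply/measurable_EFinP; have := measurable_int _ i1; rewrite E.
rewrite fineK; first by apply: eq_integral => w _; rewrite sE.
exact: (integrable_fin_num measurableT i1).
Qed.

End norm.

Lemma L2fun_shift : exists h : L2fun sigma -> L2fun sigma,
  forall f, (forall z, h f z = (z : C) * f z) /\ Vop sigma (L2class f) = L2class (h f).
Proof.
have /choice[h hP] : forall f : L2fun sigma, exists g : L2fun sigma,
    (forall z, g z = (z : C) * f z) /\ Vop sigma (L2class f) = L2class g.
  by move=> f; have [g g1 g2] := Vop_class f; exists g.
by exists h.
Qed.

Lemma L2fun_monomial : exists h : nat -> L2fun sigma, forall m (z : T), h m z = (z : C) ^+ m.
Proof.
have [h hP] := L2fun_shift.
have one : (fun _ : T => 1 : C) \in sqintegrable sigma.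
  by apply/andP; split; exact: Lfun_cst.
exists (fun m => iter m h (MkL2fun one)); elim => [|m IH] z; first by rewrite expr0.
by rewrite /= (hP _).1 IH exprS.
Qed.

Definition tens_Vop : K -> K := tens_unitary K (Vop sigma).

Lemma tens_Vop_linear : linear tens_Vop.
Proof. exact: (tens_unitaryP K (Vop sigma)).1.1. Qed.

(** Multiplying each factor by its own variable multiplies the function by the product of all
    variables: this is where W comes from. *)
Lemma represents_tens_Vop u F : represents u F ->
  represents (tens_Vop u) (fun x => (cprod x : C) * F x).
Proof.
have [h hP] := L2fun_shift.
move=> [s [-> Fs]]; exists [seq (p.1, fun i => h (p.2 i)) | p <- s]; split.
  rewrite /vec big_map; elim: s {Fs} => [|p s IH].
    rewrite !big_nil; have := tens_Vop_linear (-1) 0 0.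
    by rewrite scaler0 addr0 scaleN1r addNr.
  rewrite !big_cons tens_Vop_linear IH; congr (_ *: _ + _).
  rewrite /tens_Vop (tens_unitaryP K (Vop sigma)).2; congr (tens K _).
  by apply/funext => i; rewrite (hP _).2.
move=> x; rewrite Fs /fn big_map mulr_sumr; apply: eq_bigr => p _ /=.
rewrite mulrCA cprod_val -big_split/=; congr (_ * _); apply: eq_bigr => i _.
by rewrite (hP _).1.
Qed.

Lemma represents_iter m u F : represents u F ->
  represents (iter m tens_Vop u) (fun x => (cprod x : C) ^+ m * F x).
Proof.
move=> uF; elim: m => [|m IH].
  by apply: represents_ext uF => x; rewrite expr0 mul1r.
by apply: represents_ext (represents_tens_Vop IH) => x; rewrite exprS mulrA.
Qed.

End Rep.

Section Sqmod.
Variable R : realType.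
Local Notation C := R[i].

Lemma sqmodM (z w : C) : sqmod (z * w) = sqmod z * sqmod w.
Proof. by case: z w => a b [c e]; rewrite /sqmod /=; ring. Qed.

Lemma sqmod_ge0 (z : C) : 0 <= sqmod z.
Proof. by rewrite addr_ge0 ?sqr_ge0. Qed.

Lemma sqmodX (z : C) n : sqmod (z ^+ n) = sqmod z ^+ n.
Proof.
elim: n => [|n IH]; first by rewrite !expr0 /sqmod /= expr1n expr0n addr0.
by rewrite !exprS sqmodM IH.
Qed.

Lemma sqmod_circle (z : circle R) : sqmod z = 1.
Proof.
have := eqP (circle_valP z); case: (z : C) => a b [] /(congr1 (fun x => x ^+ 2)).
by rewrite expr1n sqr_sqrtr// addr_ge0 ?sqr_ge0.
Qed.

Lemma sqmodD (z w : C) : sqmod (z + w) <= 2 * (sqmod z + sqmod w).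
Proof.
case: z w => a b [c e]; rewrite /sqmod /=.
have := sqr_ge0 (a - c); have := sqr_ge0 (b - e); nra.
Qed.

Lemma sqmodN (z : C) : sqmod (- z) = sqmod z.
Proof. by case: z => a b; rewrite /sqmod /= !sqrrN. Qed.

(** A polynomial as a list of terms with possibly repeated exponents, the form in which it comes out
    of [closed_span]. *)
Definition sparse_eval (l : seq (C * nat)) (W : C) : C := \sum_(p <- l) p.1 * W ^+ p.2.

End Sqmod.

(** * Polynomial approximation through a cyclic vector *)

Section CyclicApproximation.
Variable R : realType.
Local Notation C := R[i].
Local Notation T := (circle R).
Variable sigma : {finite_measure set T -> \bar R}.
Variables (N : nat) (K : tensorPower (L2ips sigma) N).
Local Notation U := (@tens_Vop R sigma N K).

Lemma iterU_linear m : linear (iter m U).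
Proof.
elim: m => [|m IH] a u v //.
by rewrite !iterS IH tens_Vop_linear.
Qed.

Lemma iterUB m u v : iter m U (u - v) = iter m U u - iter m U v.
Proof. by have := iterU_linear m (-1) v u; rewrite !scaleN1r ![- _ + _]addrC. Qed.

Lemma iterU_sum m (I : Type) (r : seq I) (a : I -> C) (u : I -> K) :
  iter m U (\sum_(i <- r) a i *: u i) = \sum_(i <- r) a i *: iter m U (u i).
Proof.
elim: r => [|i r IH]; last by rewrite !big_cons iterU_linear IH.
by rewrite !big_nil; have := iterUB m 0 0; rewrite !subrr.
Qed.

(** The lift is given only as a bounded operator; its isometry on represented vectors is read off
    from the functions, as W has modulus 1. *)
Lemma represents_normU m u F : represents u F -> ips_norm (iter m U u) = ips_norm u.
Proof.
have [d [X [P [c ic]]]] := indep_exists (fun _ : 'I_N => sigma).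
move=> uF; have [_ e1] := represents_norm ic uF.
have [_ e2] := represents_norm ic (represents_iter m uF).
apply: (@pexpIrn _ 2); rewrite ?nnegrE ?ips_norm_ge0//.
apply: EFin_inj; rewrite -e1 -e2; apply: eq_integral => w _.
by rewrite sqmodM sqmodX sqmod_circle expr1n mul1r.
Qed.

(** By density from [represents_normU]. The 4 comes from using twice the triangle inequality with
    factor 2; what matters is that it does not depend on [m]. *)
Lemma iterU_bound m v : ips_norm (iter m U v) <= 4 * ips_norm v.
Proof.
(* A crude bound that depends on [m], applied only to the small error [v - u]. *)
have [M M0 MP] : exists2 M : R, 0 <= M & forall u, ips_norm (iter m U u) <= M * ips_norm u.
  have [_ [M MP]] := (tens_unitaryP K (Vop sigma)).1.
  elim: m => [|m [M' M'0 IH]]; first by exists 1 => // u; rewrite mul1r.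
  exists (`|M| * M') => [|u]; first by rewrite mulr_ge0.
  rewrite iterS; apply: (le_trans (MP _)); rewrite -mulrA.
  apply: (@le_trans _ _ (`|M| * ips_norm (iter m U u))).
    by rewrite ler_wpM2r ?ips_norm_ge0// ler_norm.
  by rewrite ler_wpM2l.
apply/ler_addgt0Pr => e e0.
have M4 : 0 < 2 * M + 4 by rewrite ltr_wpDl// mulr_ge0.
have [|u [F [uF vu]]] := @represents_dense _ _ _ K v (e / (2 * M + 4)).
  by rewrite divr_gt0.
have h1 : ips_norm (iter m U v) <= 2 * (ips_norm (iter m U (v - u)) + ips_norm (iter m U u)).
  by rewrite iterUB -[in leLHS](subrK (iter m U u) (iter m U v)) ips_normD.
have h2 : ips_norm u <= 2 * (ips_norm v + ips_norm (v - u)).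
  by rewrite (le_trans _ (ips_normB _ _))// subKr.
have h3 := MP (v - u).
rewrite (represents_normU m uF) in h1.
rewrite ltr_pdivlMr// in vu.
by nra.
Qed.

Definition sparse_op (l : seq (C * nat)) (v : K) : K := \sum_(p <- l) p.1 *: iter p.2 U v.

Lemma represents_sparse_op l u F : represents u F ->
  represents (sparse_op l u) (fun x => sparse_eval l (cprod x) * F x).
Proof.
move=> uF; have := represents_sum l (fun p => p.1) (fun p => represents_iter p.2 uF).
apply: represents_ext => x; rewrite /sparse_eval mulr_suml.
by apply: eq_bigr => p _; rewrite mulrA.
Qed.

Lemma sparse_opB l u v : sparse_op l (u - v) = sparse_op l u - sparse_op l v.
Proof.
by rewrite /sparse_op -sumrB; apply: eq_bigr => p _; rewrite iterUB scalerBr.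
Qed.

Lemma sparse_op_bound l :
  exists2 B : R, 0 <= B & forall v, ips_norm (sparse_op l v) <= B * ips_norm v.
Proof.
elim: l => [|p l [B B0 BP]].
  by exists 0 => // v; rewrite /sparse_op big_nil ips_norm0 mul0r.
have [M M0 MP] := ips_normZ K p.1.
exists (2 * (M * 4 + B)) => [|v]; first by rewrite mulr_ge0// addr_ge0// mulr_ge0// ltW.
rewrite /sparse_op big_cons -mulrA (mulrDl (M * 4)); apply: le_trans (ips_normD _ _) _.
apply: ler_wpM2l => //; apply: lerD; last exact: BP.
apply: le_trans (MP _) _; rewrite -mulrA; apply: ler_wpM2l; first exact: ltW.
exact: iterU_bound.
Qed.

(** A large power of [U] clears the finitely many negative powers in the combination and leaves a
    polynomial in [U]. Every larger power works too, so that several vectors can share one [M]. *)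
Lemma orbit_approx (S : set K) v u e : 0 < e ->
  closed_span [set w | S w /\ exists m : nat, w = iter m U v \/ iter m U w = v] u ->
  exists M0, forall M, (M0 <= M)%N -> exists l, ips_norm (sparse_op l v - iter M U u) < e.
Proof.
move=> e0 /(_ (e / 4)) []; first by rewrite divr_gt0.
move=> m [c [a [aP ua]]].
have /choice[k kP] : forall j, exists k : nat, a j = iter k U v \/ iter k U (a j) = v.
  by move=> j; have [_ [k kj]] := aP j; exists k.
exists (\sum_j k j)%N => M Mk.
have /choice[n nP] : forall j, exists n, iter M U (a j) = iter n U v.
  move=> j; have kM : (k j <= M)%N.
    by apply: leq_trans Mk; rewrite (bigD1 j)//= leq_addr.
  case: (kP j) => [->|<-]; first by exists (M + k j)%N; rewrite iterD.
  by exists (M - k j)%N; rewrite -iterD subnK.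
exists [seq (c j, n j) | j <- enum 'I_m].
rewrite /sparse_op big_map big_enum/=; under eq_bigr do rewrite -nP.
rewrite -iterU_sum -iterUB -ips_normN -scaleN1r.
rewrite (_ : _ *: _ = iter M U (u - \sum_(j < m) c j *: a j)); last first.
  by rewrite scaleN1r !iterUB opprB.
by apply: le_lt_trans (iterU_bound _ _) _; rewrite mulrC -ltr_pdivlMr.
Qed.

(** The cyclic vector [v] need not be represented by a function. The polynomials are found first,
    with [v]; only then is [v] replaced by a represented [u], close enough for the norms of these
    polynomials in [U]. *)
Lemma cyclic_approx (S : set K) (E : finType) (h : E -> K) e :
  simple_spectrum S U -> (forall i, S (h i)) -> 0 < e ->
  exists M (l : E -> seq (C * nat)) u F, represents u F /\
    forall i, ips_norm (sparse_op (l i) u - iter M U (h i)) < e.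
Proof.
move=> [v Sv SU] Sh e0.
have e40 : 0 < e / 4 by rewrite divr_gt0.
have /choice[M0 M0P] : forall i, exists M0, forall M, (M0 <= M)%N ->
    exists l, ips_norm (sparse_op l v - iter M U (h i)) < e / 4.
  by move=> i; apply: (orbit_approx e40 (SU _ (Sh i))).
pose M := (\sum_i M0 i)%N.
have /choice[l lP] : forall i, exists l, ips_norm (sparse_op l v - iter M U (h i)) < e / 4.
  by move=> i; apply: M0P; rewrite /M (bigD1 i)//= leq_addr.
have /choice[B BP] : forall i, exists B : R, 0 <= B /\
    forall v, ips_norm (sparse_op (l i) v) <= B * ips_norm v.
  by move=> i; have [B B0 BP] := sparse_op_bound (l i); exists B.
(* One bound for all the operators [sparse_op (l i)], made positive by the [+ 1]. *)
pose B1 := \sum_i B i + 1.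
have B0 i : 0 <= B i by case: (BP i).
have B10 : 0 < B1 by rewrite ltr_wpDl// sumr_ge0.
have [|u [F [uF vu]]] := @represents_dense _ _ _ K v (e / (4 * B1)).
  by rewrite divr_gt0// mulr_gt0.
exists M, l, u, F; split => // i.
have -> : sparse_op (l i) u - iter M U (h i) =
    (sparse_op (l i) v - iter M U (h i)) - sparse_op (l i) (v - u).
  by rewrite sparse_opB opprB [RHS]addrC addrA subrK.
apply: le_lt_trans (ips_normB _ _) _.
have [_ /(_ (v - u)) b1] := BP i.
have b2 : B i * ips_norm (v - u) <= B1 * ips_norm (v - u).
  rewrite ler_wpM2r ?ips_norm_ge0// /B1 (bigD1 i)//= -addrA lerDl.
  by rewrite addr_ge0// sumr_ge0.
have b3 : B1 * ips_norm (v - u) < e / 4.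
  by rewrite mulrC -ltr_pdivlMr// (lt_le_trans vu)// invfM mulrA.
by have := lP i; lra.
Qed.

End CyclicApproximation.

(** * Sequences of polynomials tending to zero at too many points *)

Section FiberBound.
Variable R : realType.
Local Notation C := R[i].

Lemma sqmod_sum (I : Type) (r : seq I) (z : I -> C) :
  sqmod (\sum_(i <- r) z i) <= 2 ^+ size r * \sum_(i <- r) sqmod (z i).
Proof.
elim: r => [|i r IH]; first by rewrite !big_nil mulr0 /sqmod /= expr0n addr0.
rewrite !big_cons /= exprS -mulrA; apply: le_trans (sqmodD _ _) _.
apply: ler_wpM2l => //; rewrite mulrDr; apply: lerD => //.
by apply: ler_peMl; [exact: sqmod_ge0|apply: exprn_ege1; rewrite ler1n].
Qed.

Lemma sqmod_sum_ord n (z : 'I_n -> C) :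
  sqmod (\sum_i z i) <= 2 ^+ n * \sum_i sqmod (z i).
Proof.
have := sqmod_sum (enum 'I_n) z.
by rewrite size_enum_ord !big_enum.
Qed.

(* Lagrange interpolation expresses the leading coefficient through the values. *)
Lemma lead_coef_interpolation D (w : 'I_D.+1 -> C) : injective w ->
  exists la : 'I_D.+1 -> C, forall a : 'I_D.+1 -> C,
    a ord0 = \sum_i la i * \sum_(e < D.+1) a e * w i ^+ (D - e).
Proof.
move=> wi; pose V := Vandermonde D.+1 (\row_i w i).
have uV : V \in unitmx.
  rewrite unitmxE det_Vandermonde unitfE; apply/prodf_neq0 => i _.
  apply/prodf_neq0 => j ij; rewrite !mxE subr_eq0.
  by apply: contraTneq ij => /wi ->; rewrite ltnn.
exists (fun i => invmx V i ord_max) => a.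
under eq_bigr do rewrite mulr_sumr.
rewrite exchange_big/=.
(* The rows of the Vandermonde matrix have increasing exponents, hence the reversed index; column
   [ord_max] of the inverse selects the top power. *)
have E (e : 'I_D.+1) : \sum_i invmx V i ord_max * (a e * w i ^+ (D - e)) = a e * (e == ord0)%:R.
  have := congr1 (fun M : 'M[C]_D.+1 => M (rev_ord e) ord_max) (mulmxV uV).
  rewrite /= !mxE => h.
  rewrite (_ : (e == ord0)%:R = (rev_ord e == ord_max)%:R); last first.
    congr (_ %:R); congr nat_of_bool; rewrite -!val_eqE/= subSS.
    by apply/eqP/eqP => [->|h']; rewrite ?subn0//; have := ltn_ord e; lia.
  rewrite -h mulr_sumr; apply: eq_bigr => i _.
  by rewrite !mxE /= subSS mulrCA [invmx V i ord_max * _]mulrC.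
under eq_bigr do rewrite E.
by rewrite (bigD1 ord0)//= mulr1 big1 ?addr0// => e /negPf ->; rewrite mulr0.
Qed.

(** Interpolation at the D + 1 points bounds the leading coefficient by [L] times the largest value,
    while the hypothesis with q + 1 > [L] makes all values smaller than that by more than a factor
    [L]. The strict inequality also forces the leading coefficient to be nonzero. *)
Lemma few_common_asymptotic_roots D (w : 'I_D.+1 -> C) (a : nat -> 'I_D.+1 -> C) :
  injective w ->
  (forall i (q : nat), exists m : nat, forall j, (m <= j)%N ->
     sqmod (\sum_(e < D.+1) a j e * w i ^+ (D - e)) * q.+1%:R < sqmod (a j ord0)) ->
  False.
Proof.
move=> wi H; have [la laP] := lead_coef_interpolation wi.
pose L := 2 ^+ D.+1 * \sum_i sqmod (la i).
have L0 : 0 <= L by rewrite mulr_ge0 ?sumr_ge0// => i _; exact: sqmod_ge0.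
pose q := Num.truncn L.
have qL : L < q.+1%:R by exact: truncnS_gt.
have /choice[m mP] := fun i => H i q.
pose j := (\sum_i m i)%N.
pose A i := sqmod (\sum_(e < D.+1) a j e * w i ^+ (D - e)).
have HA i : A i * q.+1%:R < sqmod (a j ord0).
  by apply: mP; rewrite /j (bigD1 i)//= leq_addr.
have a0 : 0 < sqmod (a j ord0).
  by apply: le_lt_trans (HA ord0); rewrite mulr_ge0// sqmod_ge0.
have : sqmod (a j ord0) * q.+1%:R <= L * sqmod (a j ord0).
  rewrite {1}laP; apply: (@le_trans _ _ (2 ^+ D.+1 * (\sum_i sqmod (la i) * A i) * q.+1%:R)).
    rewrite ler_wpM2r//; apply: le_trans (sqmod_sum_ord _) _.
    by under eq_bigr do rewrite sqmodM.
  rewrite /L -!mulrA ler_wpM2l ?exprn_ge0// !mulr_suml; apply: ler_sum => i _.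
  by rewrite -mulrA ler_wpM2l ?sqmod_ge0// ltW.
by rewrite leNgt [L * _]mulrC ltr_pM2l// qL.
Qed.

(** Here [f j] is the value of the function approximating the cyclic vector. Times [f j], the
    polynomial is close to [u j] times the one with coefficients [h], which vanishes at [w], and its
    leading coefficient is close to [u j], of modulus 1. Hence [f j] is nonzero and cancels. *)
Lemma asymptotic_root D (w : C) (a : nat -> 'I_D.+1 -> C) (f u : nat -> C) (h : 'I_D.+1 -> C) :
  sqmod w = 1 -> (forall j, sqmod (u j) = 1) -> h ord0 = 1 ->
  \sum_(e < D.+1) h e * w ^+ (D - e) = 0 ->
  (forall e eps, 0 < eps -> exists m, forall j, (m <= j)%N ->
     sqmod (a j e * f j - u j * h e) < eps) ->
  forall q : nat, exists m : nat, forall j, (m <= j)%N ->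
    sqmod (\sum_(e < D.+1) a j e * w ^+ (D - e)) * q.+1%:R < sqmod (a j ord0).
Proof.
move=> w1 u1 h0 hw H q.
(* Errors below 1/(4c) make the value at [w], times q + 1, less than 1/4 through [sqmod_sum_ord]; as
   c >= 1, they also keep the leading coefficient at least 1/4. Both bounds include the factor
   [f j]. *)
pose c : R := 2 ^+ D.+1 * D.+1%:R * q.+1%:R.
have c1 : 1 <= c by rewrite !mulr_ege1 ?ler1n// exprn_ege1// ler1n.
have c0 : 0 < c by apply: lt_le_trans c1.
have e0 : 0 < (4 * c)^-1 by rewrite invr_gt0 mulr_gt0.
have /choice[m mP] := fun e => H e _ e0.
exists (\sum_e m e)%N => j jm.
have dP e : sqmod (a j e * f j - u j * h e) < (4 * c)^-1.
  by apply: mP; apply: leq_trans jm; rewrite (bigD1 e)//= leq_addr.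
set A := \sum_(e < _) _.
have fA : sqmod (f j) * sqmod A * q.+1%:R < 1 / 4.
  rewrite -sqmodM (_ : f j * A = \sum_(e < D.+1) (a j e * f j - u j * h e) * w ^+ (D - e)).
    apply: le_lt_trans (_ : 2 ^+ D.+1 * (\sum_(e < D.+1) sqmod (a j e * f j - u j * h e)) *
        q.+1%:R < _).
      rewrite ler_wpM2r//; apply: le_trans (sqmod_sum_ord _) _.
      by under eq_bigr do rewrite sqmodM sqmodX w1 expr1n mulr1.
    have -> : 1 / 4 = 2 ^+ D.+1 * (\sum_(e < D.+1) (4 * c)^-1) * q.+1%:R :> R.
      rewrite sumr_const card_ord -(mulr_natl (4 * c)^-1) /c.
      have F (x y z : R) : x != 0 -> y != 0 -> z != 0 ->
          1 / 4 = x * (y * (4 * (x * y * z))^-1) * z.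
        by move=> x0 y0 z0; field; rewrite x0 y0 z0.
      by apply: F; rewrite ?expf_neq0 ?pnatr_eq0.
    rewrite ltr_pM2r// ltr_pM2l; last by rewrite exprn_gt0.
    by apply: ltr_sum => //; apply/hasP; exists ord0; rewrite ?mem_index_enum.
  rewrite mulr_sumr [RHS](eq_bigr (fun e : 'I_D.+1 => f j * (a j e * w ^+ (D - e)) -
     u j * (h e * w ^+ (D - e)))) => [|e _]; last by ring.
  by rewrite sumrB -[X in _ - X]mulr_sumr hw mulr0 subr0.
have a14 : 1 / 4 <= sqmod (f j) * sqmod (a j ord0).
  have := dP ord0; rewrite h0 mulr1 => d0.
  have d4 : (4 * c)^-1 <= 1 / 4 by rewrite div1r lef_pV2 ?posrE ?mulr_gt0// ler_peMr.
  have := sqmodD (a j ord0 * f j) (- (a j ord0 * f j - u j)).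
  rewrite (_ : _ + - _ = u j); last by ring.
  rewrite u1 sqmodN sqmodM; move: (lt_le_trans d0 d4).
  by rewrite mulrC; lra.
have f0 : 0 < sqmod (f j).
  rewrite lt_neqAle sqmod_ge0 andbT; apply/negP => /eqP f0.
  by move: a14; rewrite -f0 mul0r; lra.
by rewrite -(ltr_pM2l f0) mulrA; apply: lt_le_trans fA a14.
Qed.

End FiberBound.

(** * Symmetric functions of monomials *)

Section SymmetricFunctions.
Variable R : realType.
Local Notation C := R[i].
Local Notation T := (circle R).
Variable sigma : {finite_measure set T -> \bar R}.
Variables (k N : nat) (K : tensorPower (L2ips sigma) N).
Local Notation J := {ffun 'I_k -> 'I_N}.

(** Indices may repeat in [s]: there are N^k monomials, and permuting the coordinates permutes
    them. *)
Definition monomial (s : J) (x : 'I_N -> T) : C := \prod_j (x (s j) : C).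

(** The signed elementary symmetric function of the monomials, that is, the coefficient of X^(D - e)
    in the product of the X - [monomial s x], with D = N^k. *)
Definition esympoly (e : nat) (x : 'I_N -> T) : C :=
  \sum_(F : {set J} | #|F| == e) (-1) ^+ e * \prod_(s in F) monomial s x.

Lemma esympoly0 x : esympoly 0 x = 1.
Proof.
rewrite /esympoly (eq_bigl (pred1 finset.set0)) => [|F]; last by rewrite /= cards_eq0.
by rewrite big_pred1_eq expr0 mul1r big_set0.
Qed.

(** Expand the product of the [w - monomial t x], whose factor at [t = s] vanishes, and group the
    subsets by cardinality. *)
Lemma esympoly_root (D : nat) x (s : J) : #|J| = D ->
  \sum_(e < D.+1) esympoly e x * monomial s x ^+ (D - e) = 0.
Proof.
move=> JD; set w := monomial s x.
have : \prod_(t : J) (- monomial t x + w) = 0.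
  by apply/eqP/prodf_eq0; exists s => //; rewrite addNr.
rewrite bigA_distr => H; rewrite -[RHS]H {H}.
rewrite [RHS](partition_big (fun F : {set J} => inord #|F| : 'I_D.+1) predT)//=.
apply: eq_bigr => e _; rewrite /esympoly mulr_suml; apply: eq_big => F.
  by rewrite -val_eqE /= inordK// ltnS -JD max_card.
move=> /eqP <-; rewrite [RHS](bigID (mem F))/=; congr (_ * _).
  rewrite -prodr_const -big_split/=.
  by apply: eq_bigr => t tF; rewrite tF mulN1r.
rewrite (eq_bigr (fun=> w)) => [|t /negPf -> //].
rewrite prodr_const; congr (_ ^+ _); have := cardC (mem F); rewrite -JD => <-.
by rewrite addKn.
Qed.

(** The exponent of [x i] in the product of the monomials of [F], which thereby becomes an
    elementary tensor of powers. *)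
Definition multiplicity (F : {set J}) (i : 'I_N) : nat := \sum_(s in F) \sum_j (s j == i).

Lemma prod_multiplicity (F : {set J}) (x : 'I_N -> T) :
  \prod_i (x i : C) ^+ multiplicity F i = \prod_(s in F) monomial s x.
Proof.
rewrite /multiplicity; under eq_bigr do rewrite -prodrXr.
rewrite exchange_big/=; apply: eq_bigr => s _.
under eq_bigr do rewrite -prodrXr.
rewrite exchange_big/=; apply: eq_bigr => j _.
rewrite (bigD1 (s j))//= eqxx expr1 big1 ?mulr1// => i /negPf.
by rewrite eq_sym => ->; rewrite expr0.
Qed.

(** One elementary tensor for each set [F] of [e] monomials. A permutation of the factors permutes
    the sets [F] and preserves their size, so the sum is a symmetric tensor. *)
Lemma esympoly_vector (e : nat) :
  exists h : K, sym_power K h /\ represents h (esympoly e).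
Proof.
have [m mP] := L2fun_monomial sigma.
pose ten F := tens K (fun i => L2class (m (multiplicity F i))).
pose r := [seq F : {set J} <- index_enum _ | #|F| == e].
exists (\sum_(F <- r) (-1) ^+ e *: ten F); split; last first.
  have := represents_sum r (fun=> (-1) ^+ e)
    (fun F => represents_tens K (fun i => m (multiplicity F i))).
  apply: represents_ext => x; rewrite big_filter; apply: eq_bigr => F _.
  congr (_ * _); rewrite -prod_multiplicity; apply: eq_bigr => i _; exact: mP.
move=> p; have [[lp _] tp] := tens_permP K p.
have -> : tens_perm K p (\sum_(F <- r) (-1) ^+ e *: ten F) =
    \sum_(F <- r) (-1) ^+ e *: tens_perm K p (ten F).
  elim: r => [|F r IH]; last by rewrite !big_cons lp IH.
  rewrite !big_nil; have := lp (-1) 0 0.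
  by rewrite scaler0 addr0 scaleN1r addNr.
(* The preimage of [F] under composition with [p]: permuting the factors of the tensor of [F] gives
   the tensor of [act F]. *)
pose act (F : {set J}) : {set J} := finset (fun s : J => [ffun j => p (s j)] \in F).
have bij_pp : bijective (fun s : J => [ffun j => p (s j)] : J).
  exists (fun s : J => [ffun j => (p^-1)%g (s j)] : J) => s; apply/ffunP => j; rewrite !ffunE.
    by rewrite permK.
  by rewrite permKV.
have mact F i : multiplicity F (p i) = multiplicity (act F) i.
  rewrite /multiplicity (reindex _ (onW_bij _ bij_pp)) /=.
  apply: eq_big => [s|s _]; first by rewrite inE.
  by apply: eq_bigr => j _; rewrite ffunE (inj_eq perm_inj).
have -> : \sum_(F <- r) (-1) ^+ e *: tens_perm K p (ten F) =
    \sum_(F <- r) (-1) ^+ e *: ten (act F).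
  apply: eq_bigr => F _; rewrite /ten tp; congr (_ *: tens K _).
  by apply/funext => i; rewrite mact.
have bij_act : bijective act.
  have [g fg gf] := bij_pp.
  exists (fun F : {set J} => finset (fun s : J => g s \in F)) => F; apply/setP => s; rewrite !inE.
    by have /= -> := gf s.
  by have /= -> := fg s.
rewrite !big_filter [RHS](reindex _ (onW_bij _ bij_act)) /=.
apply: eq_bigl => F; congr (_ == _).
rewrite -[#|act F|]sum1_card -sum1_card (reindex _ (onW_bij _ bij_pp)) /=.
by apply: eq_bigl => s; rewrite inE.
Qed.

End SymmetricFunctions.

(** * Bound on the fibers of the product map *)

Section FiberSet.
Variable R : realType.
Local Notation C := R[i].
Local Notation T := (circle R).
Variable sigma : {finite_measure set T -> \bar R}.

Lemma cmeas_circle : cmeas (fun z : T => z : C).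
Proof.
split; first exact: measurableT_comp measurable_fst (@measurable_circle_coord R).
exact: measurableT_comp measurable_snd (@measurable_circle_coord R).
Qed.

Lemma cmeas_sparse_eval d (X : measurableType d) (l : seq (C * nat)) (f : X -> C) :
  cmeas f -> cmeas (fun x => sparse_eval l (f x)).
Proof.
move=> mf; apply: cmeas_sum => p; apply: cmeasM; first exact: cmeas_cst.
exact: cmeasX.
Qed.

Lemma measurable_sqmod d (X : measurableType d) (f : X -> C) :
  cmeas f -> measurable_fun setT (fun x => sqmod (f x)).
Proof. by move=> [f1 f2]; apply: measurable_funD; exact: measurable_funX. Qed.

(** All coefficients share the same [M] and [F], as the cancellation of [F] in [asymptotic_root]
    requires. *)
Lemma sym_approx (N k D : nat) (K : tensorPower (L2ips sigma) N) (e : R) :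
  simple_spectrum (sym_power K) (tens_unitary K (Vop sigma)) -> 0 < e ->
  exists M (l : 'I_D.+1 -> seq (C * nat)) F, forall i, exists u : K,
    represents u (fun x => sparse_eval (l i) (cprod x) * F x - (cprod x : C) ^+ M * esympoly k i
        x) /\
    ips_norm u < e.
Proof.
move=> sK e0; have /choice[h hP] := fun i : 'I_D.+1 => esympoly_vector k K i.
have [M [l [u [F [uF H]]]]] := cyclic_approx sK (fun i => (hP i).1) e0.
exists M, l, F => i; exists (sparse_op (l i) u - iter M (@tens_Vop _ _ _ K) (h i)); split => //.
have := represents_lin (-1) (represents_iter M (hP i).2) (represents_sparse_op (l i) uF).
rewrite scaleN1r addrC; apply: represents_ext => x.
by rewrite mulN1r addrC.
Qed.

(* No measurable choice of roots is needed: [G] is the set of those [(w, y)] for which [w] is an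
   asymptotic common root of the polynomials with coefficients [sparse_eval (l j e) (w y)]. *)
Lemma fiber_set (k b : nat) (K : tensorPower (L2ips sigma) (k + b)) :
  simple_spectrum (sym_power K) (tens_unitary K (Vop sigma)) ->
  exists G : set (T * T), [/\ measurable G,
    forall (w y : 'I_((k + b) ^ k).+1 -> T) W, injective w ->
      (forall i, circle_mul (w i) (y i) = W) -> exists i, ~ G (w i, y i) &
    forall d (X : measurableType d) (P : {finite_measure set X -> \bar R})
      (c : 'I_(k + b) -> X -> T), indep P (fun=> sigma) c ->
      P [set x | ~ G (cprod (fun j => c (lshift b j) x), cprod (fun j => c (rshift k j) x))] = 0%E].
Proof.
move=> sK; set D := ((k + b) ^ k)%N.
(* Errors summable in [j] turn convergence in norm into almost sure convergence, by
   [summable_integrals_cvg0]. *)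
have /choice[M] : forall j : nat, exists M, exists (l : 'I_D.+1 -> seq (C * nat)) F, forall i,
    exists u : K,
    represents u (fun x => sparse_eval (l i) (cprod x) * F x - (cprod x : C) ^+ M * esympoly k i
        x) /\
    ips_norm u < 1 / (2 ^ j.+1)%:R.
  by move=> j; apply: sym_approx => //; rewrite divr_gt0// ltr0n expn_gt0.
move=> /choice[l] /choice[F H].
pose A j (z : T * T) := \sum_(e < D.+1) sparse_eval (l j e) (circle_mul z.1 z.2) * (z.1 : C) ^+ (D
    - e).
pose B j (z : T * T) := sparse_eval (l j ord0) (circle_mul z.1 z.2).
pose G := [set z | forall q : nat, exists m : nat, forall j, (m <= j)%N ->
  sqmod (A j z) * q.+1%:R < sqmod (B j z)].
have mG : measurable G.
  apply: (measurable_forall (F := fun q : nat => [set z | exists m : nat, forall j, (m <= j)%N ->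
    sqmod (A j z) * q.+1%:R < sqmod (B j z)])) => q.
  rewrite (_ : [set z | _] = \bigcup_m [set z | forall j, (m <= j)%N ->
    sqmod (A j z) * q.+1%:R < sqmod (B j z)]); last first.
    by apply/seteqP; split => z [m]; [exists m|move=> _; exists m].
  apply: bigcup_measurable => m _.
  apply: (measurable_forall (F := fun j => [set z | (m <= j)%N ->
    sqmod (A j z) * q.+1%:R < sqmod (B j z)])) => j.
  case: (boolP (m <= j)%N) => mj; last first.
    by rewrite (_ : [set z | _] = setT)//; apply/seteqP.
  rewrite (_ : [set z | _] = [set z | sqmod (A j z) * q.+1%:R < sqmod (B j z)]); last first.
    by apply/seteqP; split => z /=; [apply|move=> ? _].
  have m1 : cmeas (fun z : T * T => z.1 : C) by apply: cmeas_comp cmeas_circle.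
  have m2 : cmeas (fun z : T * T => circle_mul z.1 z.2 : C).
    by apply: cmeas_comp cmeas_circle; exact: measurable_circle_mul.
  have mA : measurable_fun setT (fun z => sqmod (A j z) * q.+1%:R).
    apply: measurable_funM => //; apply: measurable_sqmod; apply: cmeas_sum => e.
    by apply: cmeasM; [exact: cmeas_sparse_eval|exact: cmeasX].
  have mB : measurable_fun setT (fun z => sqmod (B j z)).
    by apply: measurable_sqmod; exact: cmeas_sparse_eval.
  by apply: (measurable_preimageT (A := [set true]) (measurable_fun_ltr mA mB)).
exists G; split => //.
  move=> w y W wi wy; apply: contrapT => nG.
  have wi' : injective (fun i => w i : C) by move=> i j /val_inj /wi.
  (* The coefficients depend on the pairs only through their product W, so all the [w i] would be
     asymptotic roots of the same polynomials. *)
  apply: (few_common_asymptotic_roots wi' (a := fun j e => sparse_eval (l j e) W)) => i q.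
  have /(_ q)[m mP] : G (w i, y i) by apply: contrapT => h; apply: nG; exists i.
  by exists m => j /mP; rewrite -(wy i).
move=> d X P c ic.
set w := fun x => cprod (fun j => c (lshift b j) x); set y := fun x => cprod (fun j => c (rshift k
    j) x).
have mw : measurable_fun setT (fun x => (w x, y x)).
  by apply: measurable_fun_pair; apply: measurable_cprod => i; exact: ic.1.
suff : {ae P, forall x, G (w x, y x)}.
  move=> [E [mE E0 sE]]; apply: (subset_measure0 _ mE _ E0) => //.
  rewrite (_ : [set x | _] = ~` ((fun x => (w x, y x)) @^-1` G))//.
  by apply: measurableC; exact: measurable_preimageT.
have cw x : circle_mul (w x) (y x) = cprod (fun i => c i x).
  by rewrite [RHS]/cprod big_split_ord.
pose g (e : 'I_D.+1) j x := sqmod (sparse_eval (l j e) (cprod (fun i => c i x)) * F j (fun i => c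
    i x) -
  (cprod (fun i => c i x) : C) ^+ M j * esympoly k e (fun i => c i x)).
have : {ae P, forall x, forall e, forall eps, 0 < eps ->
    exists m, forall j, (m <= j)%N -> g e j x < eps}.
  apply: filter_forall => e; apply: summable_integrals_cvg0.
  - by move=> j; have [u [uF _]] := H j e; exact: (represents_norm ic uF).1.
  - by move=> j x; exact: sqmod_ge0.
  - move=> j; have [u [uF ul]] := H j e; rewrite (represents_norm ic uF).2 lee_fin.
    have u0 := ips_norm_ge0 u.
    (* The integral is the square of the norm, which the bound on the norm controls once the norm is
       at most 1. *)
    have u1 : ips_norm u <= 1.
      rewrite (le_trans (ltW ul))// ler_pdivrMr ?ltr0n ?expn_gt0// mul1r.
      by rewrite ler1n expn_gt0.
    by rewrite (le_trans _ (ltW ul))// expr2 ler_piMl.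
apply: filterS => x gx.
suff ar : forall q : nat, exists m : nat, forall j, (m <= j)%N ->
    sqmod (\sum_(e < D.+1) sparse_eval (l j e) (cprod (fun i => c i x)) * (w x : C) ^+ (D - e)) *
        q.+1%:R <
    sqmod (sparse_eval (l j ord0) (cprod (fun i => c i x))).
  by move=> q; have [m mP] := ar q; exists m => j /mP; rewrite -(cw x).
apply: (@asymptotic_root R D (w x) (fun j e => sparse_eval (l j e) (cprod (fun i => c i x)))
  (fun j => F j (fun i => c i x)) (fun j => (cprod (fun i => c i x) : C) ^+ M j)
  (fun e => esympoly k e (fun i => c i x))) => //.
- exact: sqmod_circle.
- by move=> j; rewrite sqmodX sqmod_circle expr1n.
- exact: esympoly0.
(* [w x], the product of the first k points, is the monomial of the map [lshift b]. *)
- have JD : #|{ffun 'I_k -> 'I_(k + b)}| = D by rewrite card_ffun !card_ord.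
  rewrite -[RHS](esympoly_root (fun i => c i x) [ffun j => lshift b j] JD).
  apply: eq_bigr => e _; congr (_ * _ ^+ _); rewrite /w cprod_val /monomial.
  by apply: eq_bigr => j _; rewrite ffunE.
Qed.

End FiberSet.

(** * An absolutely continuous part, by exhaustion *)

Lemma absolutely_continuous_part (R : realType) d (X : measurableType d)
    (rho tau : {finite_measure set X -> \bar R}) :
  (exists N, [/\ measurable N, rho N = 0%E & tau (~` N) = 0%E]) \/
  (exists S, [/\ measurable S, tau S != 0%E &
     forall A, measurable A -> rho A = 0%E -> tau (S `&` A) = 0%E]).
Proof.
pose V := [set r : R | exists A, [/\ measurable A, rho A = 0%E & r = fine (tau A)]].
have V0 : V 0 by exists set0; rewrite !measure0.
have mono A B : measurable A -> measurable B -> A `<=` B -> fine (tau A) <= fine (tau B).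
  by move=> mA mB AB; rewrite fine_le ?fin_num_measure// le_measure ?inE.
have supV : has_sup V.
  split; first by exists 0.
  by exists (fine (tau setT)) => _ [A [mA _ ->]]; exact: mono.
have /choice[A AP] : forall n : nat, exists A, [/\ measurable A, rho A = 0%E &
    sup V - n.+1%:R^-1 < fine (tau A)].
  move=> n; have [|r [A [mA A0 ->]] rA] := @sup_adherent _ V n.+1%:R^-1 _ supV.
    by rewrite invr_gt0.
  by exists A.
pose M := \bigcup_n A n.
have mM : measurable M by apply: bigcupT_measurable => n; case: (AP n).
have M0 : rho M = 0%E.
  apply/negligibleP => //; apply: negligible_bigcup => n.
  by have [mA A0 _] := AP n; apply/negligibleP.
have VM : V (fine (tau M)) by exists M.
have supM : fine (tau M) = sup V.
  apply/eqP; rewrite eq_le; apply/andP; split.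
    by apply: ub_le_sup => //; case: supV.
  apply/ler_addgt0Pr => e e0.
  pose n := Num.truncn e^-1.
  have [mA _ An] := AP n.
  have ne : n.+1%:R^-1 < e by rewrite invf_plt ?posrE// truncnS_gt.
  have : fine (tau (A n)) <= fine (tau M) by apply: mono => // x Ax; exists n.
  by move: An ne; move: (n.+1%:R^-1) (fine _) (fine _) (sup V) => t a b v; lra.
have [tM|tM] := eqVneq (tau (~` M)) 0%E; first by left; exists M.
right; exists (~` M); split => //; first exact: measurableC.
move=> B mB B0.
have mMB : measurable (~` M `&` B) by apply: measurableI => //; exact: measurableC.
have VB : V (fine (tau (M `|` (~` M `&` B)))).
  exists (M `|` (~` M `&` B)); split => //; first exact: measurableU.
  by apply: etrans M0; apply: measureU0 => //; exact: (subset_measure0 _ mB _ B0).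
have : fine (tau (M `|` (~` M `&` B))) <= fine (tau M).
  by rewrite supM; apply: ub_le_sup => //; case: supV.
rewrite measureU//; last by rewrite setIA setICr set0I.
rewrite fineD ?fin_num_measure// gerDl => le0.
apply/eqP; rewrite -fine_eq0 ?fin_num_measure// eq_le le0 fine_ge0//.
Qed.

(** * The bound on fibers in terms of convolution powers *)

Section Rows.
Variable R : realType.
Local Notation C := R[i].
Local Notation T := (circle R).
Local Notation finmeas := {finite_measure set T -> \bar R}.

Lemma indep_setT d (X : measurableType d) (P : {finite_measure set X -> \bar R})
    (I : finType) (nu : I -> finmeas) c : indep P nu c ->
  P setT = (\prod_i fine (nu i setT))%:E.
Proof.
by move=> ic; rewrite -(indep_box ic (fun=> measurableT)); congr (P _); apply/seteqP.
Qed.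

Lemma indep_split d d' (X : measurableType d) (Y : measurableType d')
    (P : {finite_measure set X -> \bar R}) (Q : {finite_measure set Y -> \bar R})
    (a b : nat) (nu : finmeas) (c : 'I_a -> X -> T) (c' : 'I_b -> Y -> T) :
  indep P (fun=> nu) c -> indep Q (fun=> nu) c' ->
  exists c2 : 'I_(a + b) -> X * Y -> T, [/\ indep (prodm P Q) (fun=> nu) c2,
    forall z, (fun i => c2 (lshift b i) z) = (fun i => c i z.1) &
    forall z, (fun i => c2 (rshift a i) z) = (fun i => c' i z.2)].
Proof.
move=> ic ic'.
have sb : bijective (@fintype.split a b) by exists unsplit; [exact: fintype.splitK|exact:
    fintype.unsplitK].
have := indep_reindex sb (indep_sum ic ic').
set nu' := fun _ => _; set c2 := fun _ => _ : X * Y -> T => ic2.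
exists c2; split.
- by move: ic2; rewrite (_ : nu' = fun=> nu)//; apply/funext => i; rewrite /nu'; case:
    (fintype.split i).
- by move=> z; apply/funext => i; rewrite /c2 -[lshift b i]/(unsplit (inl i)) fintype.unsplitK.
- by move=> z; apply/funext => i; rewrite /c2 -[rshift a i]/(unsplit (inr i)) fintype.unsplitK.
Qed.

Lemma cprod_split (a b : nat) (x : 'I_(a + b) -> T) :
  cprod x = circle_mul (cprod (fun i => x (lshift b i))) (cprod (fun i => x (rshift a i))).
Proof. exact: big_split_ord. Qed.

Lemma conv_powS (mu : finmeas) m A :
  conv_pow mu m.+1 A = prodm mu (conv_pow mu m) [set z | A (circle_mul z.1 z.2)].
Proof. exact: conv_seqS. Qed.

Lemma measurable_mul_preimage (A : set T) : measurable A ->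
  measurable [set z : T * T | A (circle_mul z.1 z.2)].
Proof.
move=> mA; apply: (measurable_preimageT (f := fun z : T * T => circle_mul z.1 z.2)) => //.
exact: measurable_circle_mul.
Qed.

Lemma indep_conv_pow (sigma : finmeas) (k m : nat) :
  exists (d : measure_display) (X : measurableType d)
    (P : {finite_measure set X -> \bar R}) (c : 'I_(m * k) -> X -> T),
    indep P (fun=> sigma) c /\ forall A, measurable A ->
      P [set w | A (cprod (fun i => c i w))] = conv_pow (conv_pow sigma k) m A.
Proof.
elim: m => [|m [d [X [P [c [ic lc]]]]]].
  have [d [X [P [c [ic lc]]]]] := indep_ord (fun _ : 'I_(0 * k) => sigma).
  exists d, X, P, c; split => // A mA; rewrite lc// /conv_pow /conv_seq big_ord0.
  by rewrite mul0n big_ord0.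
have [d' [Y [Q [c' [ic' lc']]]]] := indep_ord (fun _ : 'I_k => sigma).
have [c2 [ic2 c2l c2r]] := indep_split ic' ic.
exists _, (Y * X)%type, (prodm Q P), c2; split => // A mA.
rewrite conv_powS -(prodm_law (measurable_cprod ic'.1) (measurable_cprod ic.1) lc' lc).
  by congr (prodm _ _ _); apply/seteqP; split => z /=; rewrite (@cprod_split k (m * k)) c2l c2r.
exact: measurable_mul_preimage.
Qed.

(** The first k points give one factor of law sigma^{*k}, and the next n k points a factor of law
    (sigma^{*k})^{*n}. The last r points are frozen at a value with null section, and their product
    [u] is absorbed into the second variable; this keeps the bound on fibers. *)
Lemma fiber_set_conv_pow (sigma : finmeas) (k n r : nat)
    (K : tensorPower (L2ips sigma) (k + (n * k + r))) :
  sigma setT != 0%E ->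
  simple_spectrum (sym_power K) (tens_unitary K (Vop sigma)) ->
  exists G : set (T * T), [/\ measurable G,
    forall (w y : 'I_((k + (n * k + r)) ^ k).+1 -> T) W, injective w ->
      (forall i, circle_mul (w i) (y i) = W) -> exists i, ~ G (w i, y i) &
    prodm (conv_pow sigma k) (conv_pow (conv_pow sigma k) n) (~` G) = 0%E].
Proof.
move=> s0 sK; have [G [mG Gf Gn]] := fiber_set sK.
have [d1 [X [P [c1 [ic1 lc1]]]]] := indep_ord (fun _ : 'I_k => sigma).
have [d2 [Y [Q [c2 [ic2 lc2]]]]] := indep_conv_pow sigma k n.
have [d3 [Z [M [c3 [ic3 _]]]]] := indep_ord (fun _ : 'I_r => sigma).
(* The left-over points are moved to the front, so that freezing them is taking a section of
   [prodm]. *)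
pose h (i : 'I_(k + (n * k + r))) : 'I_r + ('I_k + 'I_(n * k)) :=
  match fintype.split i with
  | inl a => inr (inl a)
  | inr j => match fintype.split j with inl b => inr (inr b) | inr e => inl e end
  end.
pose h' (u : 'I_r + ('I_k + 'I_(n * k))) : 'I_(k + (n * k + r)) :=
  match u with
  | inl e => rshift k (rshift (n * k) e)
  | inr (inl a) => lshift (n * k + r) a
  | inr (inr b) => rshift k (lshift r b)
  end.
have E1 a : h (lshift (n * k + r) a) = inr (inl a).
  by rewrite /h -[lshift _ a]/(unsplit (inl a)) fintype.unsplitK.
have E2 b : h (rshift k (lshift r b)) = inr (inr b).
  by rewrite /h -[rshift k _]/(unsplit (inr _)) fintype.unsplitK -[lshift r b]/(unsplit (inl b))
      fintype.unsplitK.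
have E3 e : h (rshift k (rshift (n * k) e)) = inl e.
  by rewrite /h -[rshift k _]/(unsplit (inr _)) fintype.unsplitK -[rshift _ e]/(unsplit (inr e))
      fintype.unsplitK.
have bh : bijective h.
  exists h'; last by move=> [e|[a|b]]; rewrite /h' ?E1 ?E2 ?E3.
  move=> i; rewrite -[i in LHS]fintype.splitK -[RHS]fintype.splitK; case: (fintype.split i) =>
      [a|j] /=.
    by rewrite E1.
  rewrite -[j]fintype.splitK; case: (fintype.split j) => [b|e] /=; by rewrite ?E2 ?E3.
have := indep_reindex bh (indep_sum ic3 (indep_sum ic1 ic2)).
set nu' := fun _ => _; set c := fun _ => _ : Z * (X * Y) -> T => ic.
have nuE : nu' = fun=> sigma.
  by apply/funext => i; rewrite /nu'; case: (h i) => [e|[a|b]].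
rewrite nuE in ic.
have mG' : measurable [set z : Z * (X * Y) | ~ G (cprod (fun i => c1 i z.2.1),
    circle_mul (cprod (fun i => c2 i z.2.2)) (cprod (fun i => c3 i z.1)))].
  apply: (measurable_preimageT (A := ~` G) (f := fun z : Z * (X * Y) => (cprod (fun i => c1 i
      z.2.1),
    circle_mul (cprod (fun i => c2 i z.2.2)) (cprod (fun i => c3 i z.1))))); last exact:
        measurableC.
  have m21 : measurable_fun setT (fun z : Z * (X * Y) => z.2.1).
    exact: (measurableT_comp measurable_fst measurable_snd).
  have m22 : measurable_fun setT (fun z : Z * (X * Y) => z.2.2).
    exact: (measurableT_comp measurable_snd measurable_snd).
  apply: measurable_fun_pair; first exact: (measurableT_comp (measurable_cprod ic1.1) m21).
  apply: measurable_circle_mulT; first exact: (measurableT_comp (measurable_cprod ic2.1) m22).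
  exact: (measurableT_comp (measurable_cprod ic3.1) measurable_fst).
have : prodm M (prodm P Q) [set z : Z * (X * Y) | ~ G (cprod (fun i => c1 i z.2.1),
    circle_mul (cprod (fun i => c2 i z.2.2)) (cprod (fun i => c3 i z.1)))] = 0%E.
  rewrite -(Gn _ _ _ _ ic); congr (prodm _ _ _); apply/seteqP.
  have H z : (cprod (fun i => c1 i z.2.1),
      circle_mul (cprod (fun i => c2 i z.2.2)) (cprod (fun i => c3 i z.1))) =
      (cprod (fun j => c (lshift (n * k + r) j) z), cprod (fun j => c (rshift k j) z)).
    congr pair; first by congr cprod; apply/funext => j; rewrite /c E1.
    rewrite cprod_split; congr circle_mul; congr cprod; apply/funext => j.
      by rewrite /c E2.
    by rewrite /c E3.
  by split => z /=; rewrite H.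
move=> /prodm_eq0 => /(_ mG') null.
(* [M] has positive mass since [sigma] is nonzero, so not every [z] is exceptional. *)
have [z zP] : exists z, prodm P Q (xsection [set z : Z * (X * Y) | ~ G (cprod (fun i => c1 i z.2.1),
    circle_mul (cprod (fun i => c2 i z.2.2)) (cprod (fun i => c3 i z.1)))] z) = 0%E.
  apply: contrapT => /forallNP nz.
  have : M setT = 0%E.
    by rewrite -[RHS]null; congr (M _); apply/seteqP; split => z // _; apply/eqP; exact: nz.
  rewrite (indep_setT ic3) => /eqP; rewrite eqe; apply/negP/prodf_neq0 => i _.
  by rewrite fine_eq0// fin_num_measure.
pose u := cprod (fun i => c3 i z).
have mgu : measurable_fun setT (fun x : T * T => (x.1, circle_mul x.2 u)).
  by apply: measurable_fun_pair => //; apply: measurable_circle_mulT.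
exists [set x | G (x.1, circle_mul x.2 u)]; split.
- exact: (measurable_preimageT mgu mG).
- move=> w y W wi wy; apply: (Gf w (fun i => circle_mul (y i) u) (circle_mul W u)) => // i.
  by rewrite circle_mulA wy.
rewrite -(prodm_law (measurable_cprod ic1.1) (measurable_cprod ic2.1) lc1 lc2).
  rewrite -[RHS]zP; congr (prodm _ _ _); apply/seteqP; split => x /=.
    by move=> h1; rewrite /xsection/= inE.
  by rewrite /xsection/= inE.
by apply: measurableC; exact: (measurable_preimageT mgu mG).
Qed.

End Rows.

(** * Grids of points *)

Section Grids.
Variable R : realType.
Local Notation C := R[i].
Local Notation T := (circle R).
Local Notation finmeas := {finite_measure set T -> \bar R}.

Definition split_row m (L : finType) (p : 'I_m.+1 * L) : L + 'I_m * L :=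
  if unlift ord0 p.1 is Some i then inr (i, p.2) else inl p.2.

Lemma split_row0 m (L : finType) (l : L) : split_row (ord0 : 'I_m.+1, l) = inl l.
Proof. by rewrite /split_row unlift_none. Qed.

Lemma split_row_lift m (L : finType) (i : 'I_m) (l : L) :
  split_row (lift ord0 i, l) = inr (i, l).
Proof. by rewrite /split_row liftK. Qed.

Lemma split_row_bij m (L : finType) : bijective (@split_row m L).
Proof.
exists (fun u => match u with inl l => (ord0, l) | inr q => (lift ord0 q.1, q.2) end).
  by move=> [i l]; rewrite /split_row /=; case: unliftP => [j|] ->.
by case=> [l|[i l]]; rewrite ?split_row0 ?split_row_lift.
Qed.

Definition split_col n m (p : 'I_n * 'I_m.+1) : 'I_n + 'I_n * 'I_m :=
  if unlift ord0 p.2 is Some l then inr (p.1, l) else inl p.1.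

Lemma split_col_bij n m : bijective (@split_col n m).
Proof.
exists (fun u => match u with inl i => (i, ord0) | inr q => (q.1, lift ord0 q.2) end).
  by move=> [i l]; rewrite /split_col /=; case: unliftP => [j|] ->.
by case=> [i|[i l]]; rewrite /split_col ?unlift_none ?liftK.
Qed.

Definition row_prod (I L : finType) (x : I * L -> T) (i : I) : T := cprod (fun l => x (i, l)).

Lemma measurable_row_prod d (X : measurableType d) (I L : finType)
    (c : I * L -> X -> T) i : (forall p, measurable_fun setT (c p)) ->
  measurable_fun setT (fun w => row_prod (fun p => c p w) i).
Proof. by move=> mc; apply: measurable_cprod => l; exact: mc. Qed.

Lemma cprod_rows (I L : finType) (x : I * L -> T) : cprod (row_prod x) = cprod x.
Proof. by rewrite /cprod /row_prod pair_big; apply: eq_bigr => -[]. Qed.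

Section rows.
Variables (k : nat) (nu : 'I_k -> finmeas) (rho : finmeas) (S : set T).
Hypothesis mS : measurable S.
Hypothesis Sac : forall A, measurable A -> rho A = 0%E -> conv_seq nu (S `&` A) = 0%E.

Let measurable_rows d (X : measurableType d) m (c : 'I_m * 'I_k -> X -> T) :
  (forall p, measurable_fun setT (c p)) ->
  measurable [set w | forall i, S (row_prod (fun p => c p w) i)].
Proof.
move=> mc; apply: (measurable_forall (F := fun i => [set w | S (row_prod (fun p => c p w) i)])) =>
    i.
exact: (measurable_preimageT (measurable_row_prod i mc) mS).
Qed.

(** By Tonelli, the [w] whose section of [E] is not [beta]-null form a [rho]-null set. By [Sac], a
    row with product in S almost surely avoids it; for the other [w] the assumption on [beta]
    applies to the section. *)
Let first_row m d d' (X : measurableType d) (Y : measurableType d')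
    (P : {finite_measure set X -> \bar R}) (Q : {finite_measure set Y -> \bar R})
    (c : 'I_k -> X -> T) (c' : 'I_m * 'I_k -> Y -> T) (beta : finmeas) (E : set (T * T)) :
  indep P nu c -> indep Q (fun p => nu p.2) c' ->
  (forall A, measurable A -> beta A = 0%E ->
    Q [set y | (forall i, S (row_prod (fun p => c' p y) i)) /\
      A (cprod (fun p => c' p y))] = 0%E) ->
  measurable E -> prodm rho beta E = 0%E ->
  prodm P Q [set z | [/\ S (cprod (fun l => c l z.1)),
     forall i, S (row_prod (fun p => c' p z.2) i) &
     E (cprod (fun l => c l z.1), cprod (fun p => c' p z.2))]] = 0%E.
Proof.
move=> ic ic' H mE E0.
have mcp := measurable_cprod ic.1.
have mcp' := measurable_cprod ic'.1.
have mB : measurable [set z : X * Y | [/\ S (cprod (fun l => c l z.1)),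
     forall i, S (row_prod (fun p => c' p z.2) i) &
     E (cprod (fun l => c l z.1), cprod (fun p => c' p z.2))]].
  rewrite (_ : [set z | _] = [set z : X * Y | S (cprod (fun l => c l z.1))] `&`
    ([set z : X * Y | forall i, S (row_prod (fun p => c' p z.2) i)] `&`
     [set z : X * Y | E (cprod (fun l => c l z.1), cprod (fun p => c' p z.2))])); last first.
    by apply/seteqP; split => z /=; [case|case=> ? []].
  apply: measurableI.
    exact: (measurable_preimageT (measurableT_comp mcp measurable_fst) mS).
  apply: measurableI.
    exact: (measurable_preimageT measurable_snd (measurable_rows ic'.1)).
  apply: (measurable_preimageT _ mE); apply: measurable_fun_pair.
    exact: (measurableT_comp mcp measurable_fst).
  exact: (measurableT_comp mcp' measurable_snd).
apply/prodm_eq0 => //.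
move/prodm_eq0 : E0 => /(_ mE) E0.
pose N := [set w | beta (xsection E w) != 0%E].
have mN : measurable N by exact: measurable_section_neq0.
have SN0 : P [set x | (S `&` N) (cprod (fun l => c l x))] = 0%E.
  by rewrite (indep_law ic) ?Sac//; exact: measurableI.
apply: (subset_measure0 _ _ _ SN0).
- exact: measurable_section_neq0.
- exact: (measurable_preimageT mcp (measurableI _ _ mS mN)).
move=> x /=; apply: contra_neqP => /not_andP H1.
case: (pselect (S (cprod (fun l => c l x)))) => [Sx|nSx]; last first.
  rewrite (_ : xsection _ _ = set0) ?measure0//.
  by apply/seteqP; split => // y; rewrite /xsection/= inE => -[].
have /negP : ~ N (cprod (fun l => c l x)) by case: H1.
rewrite negbK => /eqP b0.
rewrite -[RHS](H _ _ b0); last exact: measurable_xsection.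
congr (Q _); apply/seteqP; split => y; rewrite /xsection/= !inE/=; first by case.
by case.
Qed.

(** [Sac] is applied to one row at a time, through [first_row]. The conclusion is an absolute
    continuity on the event that all rows lie in S. *)
Lemma rows_null m :
  exists (d : measure_display) (X : measurableType d)
    (P : {finite_measure set X -> \bar R}) (c : 'I_m * 'I_k -> X -> T),
    indep P (fun p => nu p.2) c /\ forall A, measurable A -> conv_pow rho m A = 0%E ->
      P [set x | (forall i, S (row_prod (fun p => c p x) i)) /\
        A (cprod (fun p => c p x))] = 0%E.
Proof.
elim: m => [|m [d [X [P [c [ic H]]]]]].
  have [d [X [P [c ic]]]] := indep_exists (fun p : 'I_0 * 'I_k => nu p.2).
  exists d, X, P, c; split => // A mA; rewrite /conv_pow /conv_seq big_ord0 /= /dirac indicE.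
  case: (boolP (circle1 R \in A)) => [_ /eqP|]; first by rewrite eqe oner_eq0.
  rewrite notin_setE => A1 _; rewrite (_ : [set x | _] = set0) ?measure0//.
  apply/seteqP; split => // x [_]; rewrite /cprod big1 => [//|[[]//]].
have [d' [Y [Q [c' [ic' _]]]]] := indep_ord nu.
have := indep_reindex (@split_row_bij m 'I_k) (indep_sum ic' ic).
set nu' := fun _ => _; set c2 := fun _ => _ : Y * X -> T => ic2.
have nuE : nu' = fun p => nu p.2.
  by apply/funext => -[i l]; rewrite /nu' /split_row /=; case: unliftP.
rewrite nuE in ic2.
exists _, (Y * X)%type, (prodm Q P), c2; split => // A mA; rewrite conv_powS => A0.
rewrite -[RHS](first_row ic' ic H (measurable_mul_preimage mA) A0).
have r0 z : row_prod (fun p => c2 p z) ord0 = cprod (fun l => c' l z.1).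
  by congr cprod; apply/funext => l; rewrite /c2 split_row0.
have rl z i : row_prod (fun p => c2 p z) (lift ord0 i) = row_prod (fun p => c p z.2) i.
  by congr cprod; apply/funext => l; rewrite /c2 split_row_lift.
have cE z : cprod (fun p => c2 p z) =
    circle_mul (cprod (fun l => c' l z.1)) (cprod (fun p => c p z.2)).
  rewrite -cprod_rows -[in RHS](cprod_rows (fun p => c p z.2)) -r0 {1}/cprod big_ord_recl.
  by congr circle_mul; apply: eq_bigr => i _; rewrite rl.
congr (prodm _ _ _); apply/seteqP; split => z /=; rewrite cE.
  by case=> Sr Az; split => //; [rewrite -r0|move=> i; rewrite -rl].
case=> S0 Sr Az; split => // i; case: (unliftP ord0 i) => [j|] ->.
  by rewrite rl.
by rewrite r0.
Qed.

Lemma grid_null n d (X : measurableType d) (P : {finite_measure set X -> \bar R})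
    (c : 'I_n.+1 * 'I_k -> X -> T) (G : set (T * T)) :
  indep P (fun p => nu p.2) c -> measurable G ->
  prodm rho (conv_pow rho n) (~` G) = 0%E ->
  {ae P, forall x, (forall i, S (row_prod (fun p => c p x) i)) ->
    G (row_prod (fun p => c p x) ord0,
      cprod (fun i => row_prod (fun p => c p x) (lift ord0 i)))}.
Proof.
move=> ic mG G0.
have [d1 [Y [Q [c1 [ic1 H]]]]] := rows_null n.
have [d2 [Z [M [c2 [ic2 _]]]]] := indep_ord nu.
have := indep_reindex (@split_row_bij n 'I_k) (indep_sum ic2 ic1).
set nu' := fun _ => _; set c3 := fun _ => _ : Z * Y -> T => ic3.
have nuE : nu' = fun p => nu p.2.
  by apply/funext => -[i l]; rewrite /nu' /split_row /=; case: unliftP.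
rewrite nuE in ic3.
have mcoord (p : 'I_n.+1 * 'I_k) :
  measurable_fun setT (fun x : fspace R ('I_n.+1 * 'I_k)%type => x p) by exact: measurable_coord.
pose E : set (fspace R ('I_n.+1 * 'I_k)%type) := [set x | (forall i, S (row_prod x i)) /\
    ~ G (row_prod x ord0, cprod (fun i => row_prod x (lift ord0 i)))].
have mE : measurable E.
  rewrite /E (_ : [set x | _] = [set x | forall i, S (row_prod x i)] `&`
    [set x | ~ G (row_prod x ord0, cprod (fun i => row_prod x (lift ord0 i)))]); last by [].
  apply: measurableI.
    exact: (measurable_rows (X := fspace R ('I_n.+1 * 'I_k)%type) (c := fun p x => x p) mcoord).
  apply: (measurable_preimageT (X := fspace R ('I_n.+1 * 'I_k)%type) (A := ~` G)
    (f := fun x : fspace R ('I_n.+1 * 'I_k)%type =>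
      (row_prod x ord0, cprod (fun i => row_prod x (lift ord0 i))))); last exact: measurableC.
  apply: measurable_fun_pair.
    exact: (measurable_row_prod (X := fspace R ('I_n.+1 * 'I_k)%type) (c := fun p x => x p) ord0
        mcoord).
  apply: (measurable_cprod (X := fspace R ('I_n.+1 * 'I_k)%type) (c := fun i x => row_prod x (lift
      ord0 i))) => i.
  exact: (measurable_row_prod (X := fspace R ('I_n.+1 * 'I_k)%type) (c := fun p x => x p) _ mcoord).
exists [set x | E (fun p => c p x)]; split; last by move=> x /= /not_implyP.
  exact: (measurable_preimageT (measurable_joint ic.1) mE).
rewrite [LHS](indep_unique ic ic3 mE).
rewrite -[RHS](first_row ic2 ic1 H (measurableC mG) G0).
have r0 z : row_prod (fun p => c3 p z) ord0 = cprod (fun l => c2 l z.1).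
  by congr cprod; apply/funext => l; rewrite /c3 split_row0.
have rl z i : row_prod (fun p => c3 p z) (lift ord0 i) = row_prod (fun p => c1 p z.2) i.
  by congr cprod; apply/funext => l; rewrite /c3 split_row_lift.
have cE z : cprod (fun i => row_prod (fun p => c3 p z) (lift ord0 i)) = cprod (fun p => c1 p z.2).
  by rewrite -cprod_rows; congr cprod; apply/funext => i; rewrite rl.
congr (prodm _ _ _); apply/seteqP; split => z; rewrite /E /= r0 cE.
  by case=> Sr Gz; split => //; [rewrite -r0|move=> i; rewrite -rl].
case=> S0 Sr Az; split => // i; case: (unliftP ord0 i) => [j|] ->.
  by rewrite rl.
by rewrite r0.
Qed.

End rows.

End Grids.

(** * Grids whose products all lie in a set, and their distinctness *)

Section BlowUp.
Variable R : realType.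
Local Notation C := R[i].
Local Notation T := (circle R).
Local Notation finmeas := {finite_measure set T -> \bar R}.

Lemma prodm_swap d d' (X : measurableType d) (Y : measurableType d')
    (P : {finite_measure set X -> \bar R}) (Q : {finite_measure set Y -> \bar R}) E :
  measurable E -> prodm P Q E = prodm Q P [set z | E (z.2, z.1)].
Proof.
move=> mE; have ms : measurable_fun setT (fun z : Y * X => (z.2, z.1)).
  exact: measurable_fun_pair.
apply: (@product_measure_unique _ _ _ _ _ P Q (pushm (prodm Q P) ms)) => // A B mA mB.
transitivity (prodm Q P (B `*` A)); last by rewrite prodmE// muleC.
by rewrite /= /pushm /pushforward; congr (prodm Q P _); apply/seteqP; split => -[x y] [].
Qed.

Lemma measure_neq0_subset d (X : measurableType d) (P : {finite_measure set X -> \bar R}) A B :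
  measurable A -> measurable B -> A `<=` B -> P A != 0%E -> P B != 0%E.
Proof. by move=> mA mB AB; apply: contra_neq => B0; exact: (subset_measure0 mA mB AB B0). Qed.

Definition fcons m (t : T) (x : 'I_m -> T) (l : 'I_m.+1) : T :=
  if unlift ord0 l is Some j then x j else t.

Lemma measurable_fcons d (X : measurableType d) m (f : X -> T) (g : 'I_m -> X -> T) :
  measurable_fun setT f -> (forall j, measurable_fun setT (g j)) ->
  measurable_fun setT (fun w => fcons (f w) (fun j => g j w) : fspace R 'I_m.+1).
Proof.
move=> mf mg; apply: (measurable_joint (c := fun l w => fcons (f w) (fun j => g j w) l)) => l.
by rewrite /fcons; case: unliftP => [j|] _.
Qed.

(** Replacing one variable by n independent copies raises the measure of its sections to the power
    n, which keeps positivity; the other variables follow by induction. The model is chosen before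
    [A] because the set fed to the induction varies with the copies. *)
Lemma blow_up n m (nu : 'I_m -> finmeas) :
  exists (d : measure_display) (X : measurableType d)
    (P : {finite_measure set X -> \bar R}) (c : 'I_n * 'I_m -> X -> T),
    indep P (fun p => nu p.2) c /\
    forall d' (Y : measurableType d') (Q : {finite_measure set Y -> \bar R}) c'
      (A : set (fspace R 'I_m)), indep Q nu c' -> measurable A ->
      Q [set y | A (fun l => c' l y)] != 0%E ->
      P [set x | forall phi : {ffun 'I_m -> 'I_n}, A (fun l => c (phi l, l) x)] != 0%E.
Proof.
elim: m nu => [|m IH] nu.
  have [d [X [P [c ic]]]] := indep_exists (fun p : 'I_n * 'I_0 => nu p.2).
  exists d, X, P, c; split => // d' Y Q c' A ic' mA Q0.
  (* There is a single function on ['I_0], and the empty product has total mass 1. *)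
  have A0 x : A x.
    have [y Ay] : exists y, A (fun l => c' l y).
      apply: contrapT => /forallNP nA; move/eqP: Q0; apply.
      by rewrite (_ : [set y | _] = set0) ?measure0//; apply/seteqP; split.
    by rewrite (_ : x = (fun l => c' l y))//; apply/funext => -[].
  rewrite (_ : [set x | _] = setT); last by apply/seteqP; split => // x _ phi; exact: A0.
  by rewrite (indep_setT ic) big1 => [|[i [l ll]]//]; rewrite eqe oner_eq0.
have [d1 [X [P [c [ic H]]]]] := IH (fun l => nu (lift ord0 l)).
have [d2 [Z [M [s is_]]]] := indep_exists (fun _ : 'I_n => nu ord0).
have := indep_reindex (@split_col_bij n m) (indep_sum is_ ic).
set nu' := fun _ => _; set c2 := fun _ => _ : Z * X -> T => ic2.
have nuE : nu' = fun p => nu p.2.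
  by apply/funext => -[i l]; rewrite /nu' /split_col /=; case: unliftP => [j|] ->.
rewrite nuE in ic2.
have c2E z (phi : 'I_m.+1 -> 'I_n) : (fun l => c2 (phi l, l) z) =
    fcons (s (phi ord0) z.1) (fun l => c (phi (lift ord0 l), l) z.2).
  by apply/funext => l; rewrite /c2 /split_col /fcons /=; case: unliftP => [j|] ->.
exists _, (Z * X)%type, (prodm M P), c2; split => // d' Y Q c' A ic' mA Q0.
have [d3 [W [N [e [ie _]]]]] := indep_ord (fun l => nu (lift ord0 l)).
(* [nu ord0] placed last, so that its sections are taken first *)
have mA1 : measurable [set z : W * T | A (fcons z.2 (fun l => e l z.1))].
  apply: (measurable_preimageT (f := fun z : W * T => fcons z.2 (fun l => e l z.1) : fspace R
      'I_m.+1)) => //.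
  by apply: measurable_fcons => // l; apply: measurableT_comp => //; exact: ie.1.
have QA1 : prodm N (nu ord0) [set z : W * T | A (fcons z.2 (fun l => e l z.1))] != 0%E.
  have := indep_reindex (@split0_bij m) (indep_sum (indep1 (nu ord0)) ie).
  set nu3 := fun _ => _; set c3 := fun _ => _ : T * W -> T => ic3.
  have nu3E : nu3 = nu.
    by apply/funext => l; rewrite /nu3 /split0 /=; case: unliftP => [j|] ->.
  rewrite nu3E in ic3.
  rewrite prodm_swap//; move: Q0; rewrite (indep_unique ic' ic3 mA).
  congr (_ != _); congr (prodm _ _ _); apply/seteqP.
  have E z : (fun i => c3 i z) = fcons z.1 (fun l => e l z.2).
    by apply/funext => l; rewrite /c3 /split0 /fcons; case: unliftP => [j|].
  by split => z /=; rewrite E.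
have mA2 : measurable [set z : W * Z | forall i, A (fcons (s i z.2) (fun l => e l z.1))].
  apply: (measurable_forall (F := fun i => [set z : W * Z | A (fcons (s i z.2) (fun l => e l
      z.1))])) => i.
  apply: (measurable_preimageT (f := fun z : W * Z => fcons (s i z.2) (fun l => e l z.1) : fspace
      R 'I_m.+1)) => //.
  apply: measurable_fcons => [|l]; apply: measurableT_comp => //; [exact: is_.1|exact: ie.1].
(* For fixed [w], the section is a box over the n copies, of measure the n-th power of that of the
   section in [QA1]. *)
have QA2 : prodm N M [set z : W * Z | forall i, A (fcons (s i z.2) (fun l => e l z.1))] != 0%E.
  apply: contra_neq QA1 => /prodm_eq0 => /(_ mA2) h; apply/prodm_eq0 => //.
  apply: (subset_measure0 _ _ _ h); do ?exact: measurable_section_neq0.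
  move=> w /= w0; rewrite (_ : xsection _ w =
    [set z | forall i, xsection [set z : W * T | A (fcons z.2 (fun l => e l z.1))] w (s i z)]);
        last first.
    by apply/seteqP; split => z; rewrite /xsection/= inE/= => h1 i;
      have := h1 i; rewrite inE.
  rewrite (indep_box (A := fun=> xsection [set z : W * T | A (fcons z.2 (fun l => e l z.1))] w)
      is_);
    last by move=> i; exact: measurable_xsection.
  rewrite eqe; apply/prodf_neq0 => i _; rewrite fine_eq0//.
  by rewrite fin_num_measure//; exact: measurable_xsection.
have mA3 : measurable [set z : Z * W | forall i, A (fcons (s i z.1) (fun l => e l z.2))].
  exact: (measurable_preimageT (f := fun z : Z * W => (z.2, z.1)) (measurable_fun_pair
      measurable_snd measurable_fst) mA2).
have mA4 : measurable [set z | forall phi : {ffun 'I_m.+1 -> 'I_n}, A (fun l => c2 (phi l, l) z)].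
  apply: (measurable_forall (F := fun phi : {ffun 'I_m.+1 -> 'I_n} => [set z | A (fun l => c2 (phi
      l, l) z)])) => phi.
  apply: (measurable_preimageT (f := fun z => (fun l => c2 (phi l, l) z) : fspace R 'I_m.+1)) => //.
  by apply: measurable_joint => l; exact: ic2.1.
apply: contra_neq QA2; rewrite prodm_swap// => /prodm_eq0 => /(_ mA4) h; apply/prodm_eq0 => //.
apply: (subset_measure0 _ _ _ h); do ?exact: measurable_section_neq0.
move=> z /= z0.
(* With the copies frozen at [z], these are the values of the remaining variables that suit all
   copies at once. *)
pose Az : set (fspace R 'I_m) := [set x | forall i, A (fcons (s i z) x)].
have mAz : measurable Az.
  apply: (measurable_forall (F := fun i => [set x : fspace R 'I_m | A (fcons (s i z) x)])) => i.
  apply: (measurable_preimageT (f := fun x : fspace R 'I_m => fcons (s i z) x : fspace R 'I_m.+1))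
      => //.
  apply: (measurable_fcons (X := fspace R 'I_m) (g := fun l x => x l)) => // l.
  exact: measurable_coord.
have := H _ _ _ _ Az ie mAz; rewrite (_ : [set y | _] = xsection [set z0 : Z * W | forall i, A
    (fcons (s i z0.1) (fun l => e l z0.2))] z); last first.
  by apply/seteqP; split => w; rewrite /xsection/= inE.
move=> /(_ z0); apply: measure_neq0_subset.
- apply: (measurable_forall (F := fun phi : {ffun 'I_m -> 'I_n} => [set x | Az (fun l => c (phi l,
    l) x)])) => phi.
  apply: (measurable_preimageT (f := fun x => (fun l => c (phi l, l) x) : fspace R 'I_m)) => //.
  by apply: measurable_joint => l; exact: ic.1.
- exact: measurable_xsection.
move=> x /= Hx; rewrite /xsection/= inE/= => phi; rewrite c2E/=.
have := Hx [ffun l => phi (lift ord0 l)] (phi ord0).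
rewrite [X in A (fcons _ X) -> _](_ : _ = fun l => c (phi (lift ord0 l), l) x)//.
by apply/funext => l; rewrite ffunE.
Qed.

Lemma measurable_circle_eq d (X : measurableType d) (f g : X -> T) :
  measurable_fun setT f -> measurable_fun setT g -> measurable [set x | f x = g x].
Proof.
move=> mf mg; have [f1 f2] := cmeas_comp mf (@cmeas_circle R).
have [g1 g2] := cmeas_comp mg (@cmeas_circle R).
rewrite (_ : [set x | _] =
  ((fun x => complex.Re (f x : C) - complex.Re (g x : C)) @^-1` [set 0]) `&`
  ((fun x => complex.Im (f x : C) - complex.Im (g x : C)) @^-1` [set 0])).
  apply: measurableI; apply: (measurable_preimageT _ (measurable_set1 0)); exact: measurable_funB.
apply/seteqP; split => x /=; first by move=> ->; rewrite !subrr.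
move=> [/eqP + /eqP]; rewrite !subr_eq0 => /eqP h1 /eqP h2; apply/val_inj => /=.
by case: (f x : C) (g x : C) h1 h2 => [a b] [a' b'] /= -> ->.
Qed.

(** Isolates one coordinate as the last factor of a product, so that sections fix all the others.
    The point [circle1 R] is an arbitrary value: it expresses that the other coordinates do not
    depend on [z.2]. *)
Lemma resample (I : finType) (nu : I -> finmeas) (i0 : I) :
  exists (d : measure_display) (X : measurableType d)
    (P : {finite_measure set X -> \bar R}) (c : I -> X * T -> T),
    [/\ indep (prodm P (nu i0)) nu c, forall z, c i0 z = z.2 &
        forall i z, i != i0 -> c i z = c i (z.1, circle1 R)].
Proof.
have [d [X [P [c ic]]]] := indep_exists (fun i : {i : I | i != i0} => nu (val i)).
pose h (i : I) : {i : I | i != i0} + unit := if insub i is Some j then inl j else inr tt.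
have hi0 : h i0 = inr tt by rewrite /h insubF// eqxx.
have hj (j : {i : I | i != i0}) : h (val j) = inl j by rewrite /h valK.
have bh : bijective h.
  exists (fun u => match u with inl j => val j | inr _ => i0 end); last first.
    by case=> [j|[]]; rewrite ?hi0 ?hj.
  by move=> i; rewrite /h; case: insubP => [j _ <-//|/negbNE/eqP ->].
have := indep_reindex bh (indep_sum ic (indep1 (nu i0))).
set nu' := fun _ => _; set c2 := fun _ => _ : X * T -> T => ic2.
have nuE : nu' = nu.
  apply/funext => i; rewrite /nu' /h; case: insubP => [j _ <-//|/negbNE/eqP -> //].
rewrite nuE in ic2.
exists d, X, P, c2; split => //; first by move=> z; rewrite /c2 hi0.
by move=> i z ii0; rewrite /c2 /h insubT.
Qed.

(** If phi and psi differ at l0, the point at (phi l0, l0) occurs in the first product only. With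
    the other points fixed, equality determines this point, and a single point has measure zero. *)
Lemma grid_distinct n m (nu : 'I_m -> finmeas) d (X : measurableType d)
    (P : {finite_measure set X -> \bar R}) (c : 'I_n * 'I_m -> X -> T)
    (phi psi : 'I_m -> 'I_n) :
  (forall l, continuous_measure (nu l)) -> indep P (fun p => nu p.2) c ->
  (exists l, phi l != psi l) ->
  {ae P, forall x, cprod (fun l => c (phi l, l) x) <> cprod (fun l => c (psi l, l) x)}.
Proof.
move=> cnu ic [l0 l0P].
have [d' [Y [Q [c' [ic' c'0 c'1]]]]] := resample (fun p : 'I_n * 'I_m => nu p.2) (phi l0, l0).
have mE d1 (Z : measurableType d1) (b : 'I_n * 'I_m -> Z -> T) :
    (forall p, measurable_fun setT (b p)) ->
    measurable [set x | cprod (fun l => b (phi l, l) x) = cprod (fun l => b (psi l, l) x)].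
  by move=> mb; apply: measurable_circle_eq; apply: measurable_cprod => l; exact: mb.
have mE1 := mE _ (fspace R ('I_n * 'I_m)%type) (fun p x => x p) (fun p => @measurable_coord R _ p).
exists [set x | cprod (fun l => c (phi l, l) x) = cprod (fun l => c (psi l, l) x)].
split; [exact: mE ic.1| |by move=> x /contrapT].
rewrite (indep_unique ic ic' mE1); apply/prodm_eq0; first exact: mE ic'.1.
rewrite (_ : [set x | _] = set0) ?measure0//; apply/seteqP; split => // y /=.
move=> /eqP; apply.
set E := xsection _ _.
have mEy : measurable E by apply: measurable_xsection; exact: mE ic'.1.
pose a := \big[@circle_mul R/circle1 R]_(l | l != l0) c' (phi l, l) (y, circle1 R).
pose b := cprod (fun l => c' (psi l, l) (y, circle1 R)).
have EP t : E t -> circle_mul a t = b.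
  rewrite /E /xsection/= inE/= /cprod (bigD1 l0)//= c'0/= circle_mulC => H.
  rewrite /a /b /cprod; under eq_bigr => l ll0.
    rewrite -(c'1 _ (y, t)); last by rewrite xpair_eqE negb_and ll0 orbT.
    over.
  rewrite H; apply: eq_bigr => l _; apply: c'1 => /=.
  by rewrite xpair_eqE negb_and; case: (eqVneq l l0) => [->|]; rewrite ?orbT// eq_sym l0P.
case: (pselect (exists t, E t)) => [[t0 Et0]|nE]; last first.
  by rewrite (_ : E = set0) ?measure0//; apply/seteqP; split => // t Et; apply: nE; exists t.
apply: (subset_measure0 mEy _ _ (cnu l0 t0)); last first.
  by move=> t Et /=; apply: (@circle_mulI R a); rewrite (EP _ Et) (EP _ Et0).
rewrite (_ : [set t0] = [set t | id t = t0])//.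
by apply: measurable_circle_eq; [exact: measurable_id|exact: measurable_cst].
Qed.

End BlowUp.

(** * The counting argument *)

(** The grid has n + 1 rows, n + 1 being the quotient of N by k. As N <= 2k(n + 1), it suffices that
    (2k)^k < n + 1, which is what the threshold on N gives. *)
Lemma row_count_bound (k N : nat) : (1 <= k)%N -> (k * ((2 * k) ^ k).+1 <= N)%N ->
  exists n r, N = (k + (n * k + r))%N /\ (N ^ k < n.+1 ^ k.+1)%N.
Proof.
move=> k1 hN; have hn : ((2 * k) ^ k < N %/ k)%N by rewrite leq_divRL// mulnC.
exists (N %/ k).-1, (N %% k)%N.
have n0 : (0 < N %/ k)%N by apply: leq_ltn_trans hn.
split; first by rewrite addnA -mulSn prednK// -divn_eq.
rewrite prednK//; set n := (N %/ k)%N in hn n0 *.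
have N2 : (N <= n * (2 * k))%N.
  rewrite (divn_eq N k) -/n; have := ltn_pmod N k1; nia.
apply: (@leq_ltn_trans ((n * (2 * k)) ^ k)); first by rewrite leq_exp2r.
by rewrite expnMn expnSr ltn_pmul2l ?expn_gt0 ?n0.
Qed.

Section Conclusion.
Variable R : realType.
Local Notation T := (circle R).
Local Notation finmeas := {finite_measure set T -> \bar R}.

(** To be applied with D = N^k and with k + 1 measures. The contradiction is reached at a single
    grid [x], taken off finitely many null sets. *)
Lemma finite_fibers_null (rho : finmeas) (k n D : nat) (nu : 'I_k -> finmeas) (S : set T) (G : set
    (T * T)) :
  (forall l, continuous_measure (nu l)) ->
  measurable S -> (forall A, measurable A -> rho A = 0%E -> conv_seq nu (S `&` A) = 0%E) ->
  measurable G -> prodm rho (conv_pow rho n) (~` G) = 0%E ->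
  (forall (w y : 'I_D.+1 -> T) W, injective w ->
      (forall i, circle_mul (w i) (y i) = W) -> exists i, ~ G (w i, y i)) ->
  (D < n.+1 ^ k)%N -> conv_seq nu S = 0%E.
Proof.
move=> cnu mS Sac mG G0 Gf Dn; apply/eqP; apply: contrapT => /negP tS.
have [d [X [P [c [ic B]]]]] := blow_up n.+1 nu.
have [dy [Y [Q [c' [ic' lc']]]]] := indep_ord nu.
have mA : measurable [set x : fspace R 'I_k | S (cprod x)].
  apply: (measurable_preimageT _ mS).
  by apply: (measurable_cprod (X := fspace R 'I_k) (c := fun i x => x i)) => i; exact:
      measurable_coord.
have PB : P [set x | forall phi : {ffun 'I_k -> 'I_n.+1}, S (cprod (fun l => c (phi l, l) x))] !=
    0%E.
  by apply: (B _ _ _ _ _ ic' mA); rewrite [X in X != _](lc' S).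
have mB : measurable [set x | forall phi : {ffun 'I_k -> 'I_n.+1}, S (cprod (fun l => c (phi l, l)
    x))].
  apply: (measurable_forall (F := fun phi : {ffun 'I_k -> 'I_n.+1} => [set x | S (cprod (fun l =>
      c (phi l, l) x))])) => phi.
  by apply: (measurable_preimageT _ mS); apply: measurable_cprod => l; exact: ic.1.
(* In column l, exchange the rows 0 and [phi l]. Each column has a single law, so the permuted grid
   is again independent with the same laws. *)
pose h (phi : {ffun 'I_k -> 'I_n.+1}) (p : 'I_n.+1 * 'I_k) := (tperm ord0 (phi p.2) p.1, p.2).
have hb phi : bijective (h phi) by exists (h phi) => -[i l]; rewrite /h /= tpermK.
have ae1 : {ae P, forall x phi, (forall i, S (row_prod (fun p => c (h phi p) x) i)) ->
    G (row_prod (fun p => c (h phi p) x) ord0,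
      cprod (fun i => row_prod (fun p => c (h phi p) x) (lift ord0 i)))}.
  apply: filter_forall => phi.
  exact: (grid_null mS Sac (indep_reindex (hb phi) ic) mG G0).
have ae2 : {ae P, forall x (q : {ffun 'I_k -> 'I_n.+1} * {ffun 'I_k -> 'I_n.+1}), q.1 != q.2 ->
    cprod (fun l => c (q.1 l, l) x) <> cprod (fun l => c (q.2 l, l) x)}.
  apply: filter_forall => -[phi psi] /=.
  case: (eqVneq phi psi) => [_|pq]; first by apply: aeW.
  have [l lP] : exists l, phi l != psi l.
    apply: contrapT => /forallNP H; move/eqP: pq; apply; apply/ffunP => l.
    by apply/eqP; apply: contrapT => /negP; exact: H.
  by apply: filterS (grid_distinct cnu ic (ex_intro _ l lP)) => x Hx _.
have [E [mE E0 sE]] := filterI ae1 ae2.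
have [x Bx Ex] : exists2 x, (forall phi : {ffun 'I_k -> 'I_n.+1}, S (cprod (fun l => c (phi l, l)
    x))) & ~ E x.
  apply: contrapT => nx; move/eqP: PB; apply; apply: (subset_measure0 mB mE _ E0).
  by move=> x Bx; apply: contrapT => nE; apply: nx; exists x.
have [H1 H2] : (forall phi, (forall i, S (row_prod (fun p => c (h phi p) x) i)) ->
    G (row_prod (fun p => c (h phi p) x) ord0,
      cprod (fun i => row_prod (fun p => c (h phi p) x) (lift ord0 i)))) /\
   (forall q : {ffun 'I_k -> 'I_n.+1} * {ffun 'I_k -> 'I_n.+1}, q.1 != q.2 ->
    cprod (fun l => c (q.1 l, l) x) <> cprod (fun l => c (q.2 l, l) x)).
  by apply: contrapT => nH; apply: Ex; exact: sE.
have cD : (D.+1 <= #|{ffun 'I_k -> 'I_n.+1}|)%N by rewrite card_ffun !card_ord.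
pose f (i : 'I_D.+1) : {ffun 'I_k -> 'I_n.+1} := enum_val (widen_ord cD i).
have fi : injective f by move=> i j /enum_val_inj /(congr1 val) /= ij; exact: val_inj.
have r0 phi : row_prod (fun p => c (h phi p) x) ord0 = cprod (fun l => c (phi l, l) x).
  by congr cprod; apply/funext => l; rewrite /h /= tpermL.
have winj : injective (fun i => row_prod (fun p => c (h (f i) p) x) ord0).
  move=> i j; rewrite !r0 => wij; apply: fi; apply: contrapT => /eqP ij.
  exact: (H2 (f i, f j) ij).
have [|a] := Gf _ (fun i => cprod (fun j => row_prod (fun p => c (h (f i) p) x) (lift ord0 j)))
   (cprod (fun p => c p x)) winj.
  move=> i; rewrite -(cprod_reindex _ (hb (f i))) -[RHS]cprod_rows.
  by rewrite [RHS]/cprod big_ord_recl.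
apply; apply: H1 => j.
(* Row j of the permuted grid is itself one of the products w_psi: this is why all of them, and not
   only the rows, were put in S. *)
have := Bx [ffun l => tperm ord0 (f a l) j].
rewrite (_ : (fun l => _) = (fun l => c (h (f a) (j, l)) x))//.
by apply/funext => l; rewrite ffunE.
Qed.

End Conclusion.

Theorem corollary3p8 (R : realType)
  (sigma : {finite_measure set (circle R) -> \bar R})
  (K : forall n : nat, tensorPower (L2ips sigma) n) :
  continuous_measure sigma ->
  (forall N : nat, exists n : nat, (N <= n)%N /\
     simple_spectrum (sym_power (K n)) (tens_unitary (K n) (Vop sigma))) ->
  forall k : nat, (1 <= k)%N -> CS k.+1 (conv_pow sigma k).
Proof.
move=> _ H k k1 nu cnu.
(* If sigma vanishes, so does sigma^{*k}, because k >= 1. Otherwise the left-over points have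
   positive mass, as [fiber_set_conv_pow] requires. *)
have [s0|s0] := eqVneq (sigma setT) 0%E.
  exists setT; split => //; last by rewrite setCT measure0.
  have [d [X [P [c [ic lc]]]]] := indep_ord (fun _ : 'I_k => sigma).
  rewrite -[LHS](lc _ measurableT) -[LHS]/(P setT) (indep_setT ic).
  by rewrite (bigD1 (Ordinal k1))//= s0 mul0r.
case: (absolutely_continuous_part (conv_pow sigma k) (conv_seq nu)) => [//|[S [mS tS Sac]]].
have [N [hN]] := H (k * ((2 * k) ^ k).+1)%N.
have [n [r [-> bound]]] := row_count_bound k1 hN => sK.
have [G [mG Gf G0]] := fiber_set_conv_pow s0 sK.
move: tS; rewrite (finite_fibers_null cnu mS Sac mG G0 Gf) ?eqxx//.
Qed.
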